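(* Let $\mathbb P$ be an i.i.d. product measure on $\Omega=\Gamma^{\mathbb Z^d}$ ($\Gamma$ Polish), let $\mathcal R\subset\mathbb Z^d$ be finite with $0\notin\mathcal U=\mathrm{co}\,\mathcal R$ and such that $\mathbb Z^d$ is the smallest additive group containing $\mathcal R$, and let $V:\Omega\times\mathcal R\to\mathbb R$ be measurable such that for each $z\in\mathcal R$ the function $V(\cdot,z)$ depends on only finitely many coordinates of $\omega$ and $V(\cdot,z)\in L^p(\mathbb P)$ for some $p>d$. Then for each $\xi$ in the relative interior $\mathrm{ri}\,\mathcal U$, $$g_{\rm pp}(\xi)=\inf_{B\in\mathcal K}\ \mathbb P\text{-}\operatorname*{ess\,sup}_\omega\ \max_{z\in\mathcal R}\{V(\omega,z)-B(\omega,0,z)-h(B)\cdot\xi\}.$$ For each $\xi\in\mathrm{ri}\,\mathcal U$ there exists a minimizing $B\in\mathcal K$ such that $h(B)$ is dual to $\xi$.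
   Context: Elements of $\Omega$ are environments $\omega=(\omega_x)_{x\in\mathbb Z^d}$; shifts act by $(\theta_x\omega)_y=\omega_{x+y}$. $\mathrm{co}\,\mathcal R$ is the convex hull. A path $x_{0,n}=(x_k)_{k=0}^n\subset\mathbb Z^d$ is admissible if its steps $z_k=x_k-x_{k-1}$ lie in $\mathcal R$. Point-to-point last-passage value with restricted path length: $G_{x,(n),y}=\max\sum_{k=0}^{n-1}V(\theta_{x_k}\omega,z_{k+1})$ over admissible $n$-step paths with $x_0=x$, $x_n=y$ (and $-\infty$ if there are none). Point-to-level value with tilt $h\in\mathbb R^d$: $G_n(h)=\max_{x_{0,n}:x_0=0}\{\sum_{k=0}^{n-1}V(\theta_{x_k}\omega,z_{k+1})+h\cdot x_n\}$. Under the stated assumptions it is known (taken for granted) that there are nonrandom finite functions $g_{\rm pl}:\mathbb R^d\to\mathbb R$ (convex, Lipschitz) and $g_{\rm pp}:\mathcal U\to\mathbb R$ (concave, continuous) with, $\mathbb P$-a.s., $g_{\rm pl}(h)=\lim_{n}n^{-1}G_n(h)$ and $g_{\rm pp}(\xi)=\lim_n n^{-1}G_{0,(n),[n\xi]}$, where $[n\xi]$ denotes a point reachable from $0$ in exactly $n$ admissible steps and approximately equal to $n\xi$ (within a distance bounded uniformly in $n$); moreover $g_{\rm pl}(h)=\sup_{\xi\in\mathcal U}\{g_{\rm pp}(\xi)+h\cdot\xi\}$. A pair $\xi\in\mathcal U$, $h\in\mathbb R^d$ is called dual if $g_{\rm pl}(h)=g_{\rm pp}(\xi)+h\cdot\xi$.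 A measurable $B:\Omega\times\mathbb Z^d\times\mathbb Z^d\to\mathbb R$ is a stationary cocycle if for $\mathbb P$-a.e. $\omega$ and all $x,y,z\in\mathbb Z^d$: $B(\omega,x+z,y+z)=B(\theta_z\omega,x,y)$ and $B(\omega,x,y)+B(\omega,y,z)=B(\omega,x,z)$. $\mathcal K$ is the space of stationary cocycles with $\mathbb E|B(x,y)|<\infty$ for all $x,y$. For $B\in\mathcal K$, $h(B)\in\mathbb R^d$ is the vector determined by $\mathbb E[B(0,x)]=-h(B)\cdot x$ for all $x\in\mathbb Z^d$. *)

(* Defs.v *)
From HB Require Import structures.
From mathcomp Require Import all_boot all_order all_algebra finmap.
From mathcomp Require Import all_classical all_reals all_analysis ess_sup_inf.

Set Implicit Arguments.
Unset Strict Implicit.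
Unset Printing Implicit Defensive.

Import Order.TTheory GRing.Theory Num.Theory.
Import numFieldNormedType.Exports.

Local Open Scope classical_set_scope.
Local Open Scope ring_scope.

Definition polish (R : realType) (T : topologicalType) : Prop :=
  (exists2 D : set T, countable D & dense D) /\
  exists rho : T -> T -> R,
    [/\ (forall x y, 0 <= rho x y) /\ (forall x y, rho x y = 0 <-> x = y),
        (forall x y, rho x y = rho y x) /\
        (forall x y z, rho x z <= rho x y + rho y z),
        forall x, nbhs x =
          filter_from [set e : R | 0 < e] (fun e => [set y | rho x y < e])
      & forall u : nat -> T,
          (forall e : R, 0 < e -> exists N, forall m n,
             (N <= m)%N -> (N <= n)%N -> rho (u m) (u n) < e) ->
          exists l : T, u @ \oo --> l].

Definition borel (T : ptopologicalType) := g_sigma_algebraType (@open T).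

(* On env d Gamma, the product sigma-algebra; for Gamma Polish this is also the
   Borel sigma-algebra of the product topology, 'rV[int]_d being countable. *)
Definition cylinders (d : nat) (Gamma : ptopologicalType) :
    set (set ('rV[int]_d -> Gamma)) :=
  [set C | exists x : 'rV[int]_d, exists2 A : set (borel Gamma),
     measurable A & C = [set w | A (w x)]].

Definition env (d : nat) (Gamma : ptopologicalType) :=
  g_sigma_algebraType (@cylinders d Gamma).

Definition shift (d : nat) (Gamma : ptopologicalType) (x : 'rV[int]_d)
  (w : env d Gamma) : env d Gamma := fun y => w (x + y).

Definition iid_product (R : realType) (d : nat) (Gamma : ptopologicalType)
    (P : probability (env d Gamma) R) : Prop :=
  exists mu : probability (borel Gamma) R,
    forall (F : {fset 'rV[int]_d}) (A : 'rV[int]_d -> set (borel Gamma)),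
      (forall x, measurable (A x)) ->
      P [set w | forall x, x \in F -> A x (w x)] = (\prod_(x <- F) mu (A x))%E.

Definition depends_on_finitely_many (R : realType) (d : nat)
    (Gamma : ptopologicalType) (f : env d Gamma -> R) : Prop :=
  exists F : {fset 'rV[int]_d}, forall w w' : env d Gamma,
    (forall x, x \in F -> w x = w' x) -> f w = f w'.

Definition additive_subgroup (d : nat) (H : set 'rV[int]_d) : Prop :=
  H 0 /\ forall x y, H x -> H y -> H (x - y).

Definition generates (d : nat) (steps : {fset 'rV[int]_d}) : Prop :=
  smallest (@additive_subgroup d) [set` steps] = setT.

Definition toR (R : realType) (d : nat) (x : 'rV[int]_d) : 'rV[R]_d :=
  map_mx intr x.
Arguments toR R [d] x.

Definition dot (R : realType) (d : nat) (u v : 'rV[R]_d) : R :=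
  \sum_(i < d) u ord0 i * v ord0 i.

Definition hull (R : realType) (d : nat) (steps : {fset 'rV[int]_d}) :
    set 'rV[R]_d :=
  smallest (@convex_set R 'rV[R]_d) (@toR R d @` [set` steps]).
Arguments hull R [d] steps.

Definition affine_set (R : realType) (d : nat) (A : set 'rV[R]_d) : Prop :=
  forall (x y : 'rV[R]_d) (t : R), A x -> A y -> A ((1 - t) *: x + t *: y).

Definition affine_hull (R : realType) (d : nat) (A : set 'rV[R]_d) :
  set 'rV[R]_d := smallest (@affine_set R d) A.

Definition relative_interior (R : realType) (d : nat) (A : set 'rV[R]_d) :
    set 'rV[R]_d :=
  [set x | A x /\ \forall y \near x, affine_hull A y -> A y].

(* Paths are sequences of which only the entries 0, ..., n matter. *)
Definition admissible (d : nat) (steps : {fset 'rV[int]_d}) (n : nat)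
    (x : nat -> 'rV[int]_d) : Prop :=
  forall k, (k < n)%N -> x k.+1 - x k \in steps.

Definition passage_time (R : realType) (d : nat) (Gamma : ptopologicalType)
    (V : env d Gamma -> 'rV[int]_d -> R) (w : env d Gamma) (n : nat)
    (x : nat -> 'rV[int]_d) : R :=
  \sum_(k < n) V (shift (x k) w) (x k.+1 - x k).

(* The suprema defining G_point and G_level run over finitely many values,
   hence are maxima; the supremum of the empty set is -oo. *)
Definition G_point (R : realType) (d : nat) (Gamma : ptopologicalType)
    (steps : {fset 'rV[int]_d}) (V : env d Gamma -> 'rV[int]_d -> R)
    (a : 'rV[int]_d) (n : nat) (b : 'rV[int]_d) (w : env d Gamma) : \bar R :=
  ereal_sup [set (passage_time V w n x)%:E |
    x in [set x | [/\ x 0%N = a, x n = b & admissible steps n x]]].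

Definition G_level (R : realType) (d : nat) (Gamma : ptopologicalType)
    (steps : {fset 'rV[int]_d}) (V : env d Gamma -> 'rV[int]_d -> R)
    (n : nat) (h : 'rV[R]_d) (w : env d Gamma) : \bar R :=
  ereal_sup [set (passage_time V w n x + dot h (toR R (x n)))%:E |
    x in [set x | x 0%N = 0 /\ admissible steps n x]].

(* br n xi is the lattice point usually written [n xi]. *)
Definition lattice_approx (R : realType) (d : nat) (steps : {fset 'rV[int]_d})
    (br : nat -> 'rV[R]_d -> 'rV[int]_d) : Prop :=
  forall xi, hull R steps xi ->
    (forall n, exists x : nat -> 'rV[int]_d,
       [/\ x 0%N = 0, x n = br n xi & admissible steps n x]) /\
    exists C : R, forall n, `|toR R (br n xi) - n%:R *: xi| <= C.

Definition is_gpl (R : realType) (d : nat) (Gamma : ptopologicalType)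
    (P : probability (env d Gamma) R) (steps : {fset 'rV[int]_d})
    (V : env d Gamma -> 'rV[int]_d -> R) (gpl : 'rV[R]_d -> R) : Prop :=
  forall h : 'rV[R]_d, \forall w \ae P,
    ((n%:R^-1)%:E * G_level steps V n h w)%E @[n --> \oo] --> (gpl h)%:E.

Definition is_gpp (R : realType) (d : nat) (Gamma : ptopologicalType)
    (P : probability (env d Gamma) R) (steps : {fset 'rV[int]_d})
    (V : env d Gamma -> 'rV[int]_d -> R)
    (br : nat -> 'rV[R]_d -> 'rV[int]_d) (gpp : 'rV[R]_d -> R) : Prop :=
  forall xi : 'rV[R]_d, hull R steps xi -> \forall w \ae P,
    ((n%:R^-1)%:E * G_point steps V 0 n (br n xi) w)%E @[n --> \oo]
      --> (gpp xi)%:E.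

Definition dual (R : realType) (d : nat) (gpl gpp : 'rV[R]_d -> R)
    (xi h : 'rV[R]_d) : Prop :=
  gpl h = gpp xi + dot h xi.

Definition stationary_cocycle (R : realType) (d : nat)
    (Gamma : ptopologicalType) (P : probability (env d Gamma) R)
    (B : env d Gamma -> 'rV[int]_d -> 'rV[int]_d -> R) : Prop :=
  (forall x y, measurable_fun [set: env d Gamma] (fun w => B w x y)) /\
  \forall w \ae P, forall x y z,
    B w (x + z) (y + z) = B (shift z w) x y /\ B w x y + B w y z = B w x z.

Definition K_space (R : realType) (d : nat) (Gamma : ptopologicalType)
    (P : probability (env d Gamma) R) :
    set (env d Gamma -> 'rV[int]_d -> 'rV[int]_d -> R) :=
  [set B | stationary_cocycle P B /\
     forall x y, P.-integrable [set: env d Gamma] (fun w => (B w x y)%:E)].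

(* For B in K_space P there is exactly one vector in the set below; outside of
   K_space P the default value 0 may be returned. *)
Definition h_of (R : realType) (d : nat) (Gamma : ptopologicalType)
    (P : probability (env d Gamma) R)
    (B : env d Gamma -> 'rV[int]_d -> 'rV[int]_d -> R) : 'rV[R]_d :=
  xget 0 [set h : 'rV[R]_d | forall x : 'rV[int]_d,
    ('E_P[fun w => B w 0%R x])%E = (- dot h (toR R x))%:E].

Definition cocycle_bound (R : realType) (d : nat) (Gamma : ptopologicalType)
    (P : probability (env d Gamma) R) (steps : {fset 'rV[int]_d})
    (V : env d Gamma -> 'rV[int]_d -> R) (xi : 'rV[R]_d)
    (B : env d Gamma -> 'rV[int]_d -> 'rV[int]_d -> R) : \bar R :=
  ess_sup P (fun w => \big[maxe/-oo%E]_(z <- steps)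
    (V w z - B w 0 z - dot (h_of P B) xi)%:E).

(* Main.v *)
(* If B is a cocycle with V - B(0,z) <= s on all steps z, then passage times to
   [n xi] are at most B(0,[n xi]) + n s, and Fatou's lemma turns the mean of B
   into the bound gpp xi + h(B).xi <= s.  This gives "<=" in the formula.

   For a minimizer, take h dual to xi, which exists by a subgradient argument in
   the relative interior.  The Cesaro average u_N of the point-to-level values
   U_1, ..., U_N of the tilted potential min(V, M) yields the cocycle
   u_N(theta_x w) - u_N(theta_y w) - h.(y - x), which dominates min(V, M) on the
   steps up to U_N / N, whose limit superior is at most gpl h.  A cocycle limit as
   N and then M tend to infinity is extracted by a convexity argument: in a
   decreasing sequence of convex sets of integrable cocycles bounded from below,
   minimising the sum over z of E exp(- B(0,z)) gives almost surely convergent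
   representatives.  Fatou's lemma only yields E B(0,z) <= - h.z in the limit,
   that is h(B).z >= h.z; applying the first part to all points of the hull gives
   gpl(h(B)) <= gpl h, so that h(B) is still dual to xi and
   gpl h = gpp xi + h(B).xi. *)
From HB Require Import structures.
Require Import Defs.
From mathcomp Require Import all_boot all_order all_algebra finmap.
From mathcomp Require Import all_classical all_reals all_analysis ess_sup_inf.
From mathcomp Require Import measurable_realfun ring lra.

Set Implicit Arguments.
Unset Strict Implicit.
Unset Printing Implicit Defensive.

Import Order.TTheory GRing.Theory Num.Theory.
Import numFieldNormedType.Exports.

Local Open Scope classical_set_scope.
Local Open Scope ring_scope.

Local Notation shift := Defs.shift.

Lemma bigmax_attained (R : realType) (I : eqType) (s : seq I) (i0 : I) (F : I -> R) :
  i0 \in s -> exists2 i, i \in s & \big[Num.max/F i0]_(j <- s) F j = F i.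
Proof.
(* The default value of the maximum belongs to [i0], which is lost once the head of [s] is removed;
   the disjunction makes the induction possible. *)
move=> i0s; suff [i] : exists2 i, (i == i0) || (i \in s) &
    \big[Num.max/F i0]_(j <- s) F j = F i.
  by move=> /orP[/eqP ->|is_] H; [exists i0|exists i].
elim: s {i0s} => [|j s [i is_ IH]]; first by exists i0; rewrite ?eqxx// big_nil.
rewrite big_cons IH /Num.max; case: ifP => _.
  by exists i => //; rewrite in_cons orbCA is_ orbT.
by exists j => //; rewrite mem_head orbT.
Qed.

(** * Integrable real functions and their means *)

Section mean.
Context d (T : measurableType d) (R : realType) (P : probability T R).
Implicit Types (f g : T -> R) (c : R).

Definition L1 f := P.-integrable setT (EFin \o f).
Definition E f : R := \int[P]_(x in setT) f x.

Lemma L1_measurable f : L1 f -> measurable_fun setT f.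
Proof. by move=> /measurable_int /measurable_EFinP. Qed.

Lemma L1_EFinE f : L1 f -> (\int[P]_(x in setT) (f x)%:E)%E = (E f)%:E.
Proof. by move=> if_; rewrite /E /Rintegral fineK//; exact: integrable_fin_num. Qed.

Lemma L1_cst c : L1 (fun=> c).
Proof. exact: finite_measure_integrable_cst. Qed.

Lemma E_cst c : E (fun=> c) = c.
Proof. by rewrite /E Rintegral_cst//= -[X in fine X]/(P setT) probability_setT mulr1. Qed.

Lemma L1D f g : L1 f -> L1 g -> L1 (fun x => f x + g x).
Proof. by move=> if_ ig; apply: (integrableD measurableT if_ ig). Qed.

Lemma L1B f g : L1 f -> L1 g -> L1 (fun x => f x - g x).
Proof. by move=> if_ ig; apply: (integrableB measurableT if_ ig). Qed.

Lemma L1Z c f : L1 f -> L1 (fun x => c * f x).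
Proof. by move=> if_; apply: (integrableZl measurableT c if_). Qed.

Lemma L1_norm f : L1 f -> L1 (fun x => `|f x|).
Proof. by move=> if_; apply: (integrable_norm if_). Qed.

Lemma L1_sum (I : Type) (s : seq I) (h : I -> T -> R) :
  (forall i, L1 (h i)) -> L1 (fun x => \sum_(i <- s) h i x).
Proof.
move=> ih; elim: s => [|i s IH].
  by under eq_fun do rewrite big_nil; exact: L1_cst.
by under eq_fun do rewrite big_cons; exact: L1D.
Qed.

Lemma L1_le f g : measurable_fun setT f -> (forall x, `|f x| <= g x) ->
  L1 g -> L1 f.
Proof.
move=> mf fg; apply: le_integrable => //; first exact/measurable_EFinP.
by move=> x _; rewrite lee_fin (le_trans (fg x))// ler_norm.
Qed.

Lemma L1_max f g : L1 f -> L1 g -> L1 (fun x => Num.max (f x) (g x)).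
Proof.
move=> if_ ig; apply: (L1_le _ _ (L1D (L1_norm if_) (L1_norm ig))).
  by apply: measurable_maxr; exact: L1_measurable.
by move=> x; rewrite /Num.max; case: ifP => _;
  [rewrite ler_wpDl|rewrite ler_wpDr].
Qed.

Lemma L1_min f g : L1 f -> L1 g -> L1 (fun x => Num.min (f x) (g x)).
Proof.
move=> if_ ig; apply: (L1_le _ _ (L1D (L1_norm if_) (L1_norm ig))).
  by apply: measurable_minr; exact: L1_measurable.
by move=> x; rewrite /Num.min; case: ifP => _;
  [rewrite ler_wpDr|rewrite ler_wpDl].
Qed.

Lemma L1_bigmax (I : eqType) (s : seq I) (F0 : T -> R) (F : I -> T -> R) :
  L1 F0 -> (forall i, i \in s -> L1 (F i)) ->
  L1 (fun w => \big[Num.max/F0 w]_(i <- s) F i w).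
Proof.
move=> l0; elim: s => [|i s IH] Fs; first by under eq_fun do rewrite big_nil.
under eq_fun do rewrite big_cons.
apply: L1_max; first by apply: Fs; exact: mem_head.
by apply: IH => j js; apply: Fs; rewrite in_cons js orbT.
Qed.

Lemma ED f g : L1 f -> L1 g -> E (fun x => f x + g x) = E f + E g.
Proof. exact: RintegralD. Qed.

Lemma EB f g : L1 f -> L1 g -> E (fun x => f x - g x) = E f - E g.
Proof. exact: RintegralB. Qed.

Lemma EZ c f : L1 f -> E (fun x => c * f x) = c * E f.
Proof. exact: RintegralZl. Qed.

Lemma E_sum (I : Type) (s : seq I) (h : I -> T -> R) :
  (forall i, L1 (h i)) -> E (fun x => \sum_(i <- s) h i x) = \sum_(i <- s) E (h i).
Proof.
move=> ih; elim: s => [|i s IH].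
  by under eq_fun do rewrite big_nil; rewrite E_cst big_nil.
under eq_fun do rewrite big_cons.
by rewrite big_cons ED ?IH//; exact: L1_sum.
Qed.

Lemma E_ae_eq f g : L1 f -> L1 g -> (\forall x \ae P, f x = g x) -> E f = E g.
Proof.
move=> if_ ig fg; rewrite /E /Rintegral; congr fine.
apply: ae_eq_integral => //; [exact: measurable_int if_|exact: measurable_int ig|].
by apply: filterS fg => x /= -> _.
Qed.

Lemma E_ge0 f : (forall x, 0 <= f x) -> 0 <= E f.
Proof. by move=> f0; exact: Rintegral_ge0. Qed.

(** The minimum of [f] and [g] equals [f] almost surely and lies below [g] everywhere, so pointwise
    monotonicity applies to it. *)
Lemma E_ae_le f g : L1 f -> L1 g -> (\forall x \ae P, f x <= g x) -> E f <= E g.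
Proof.
move=> if_ ig fg.
rewrite -(@E_ae_eq (fun x => Num.min (f x) (g x)) f) //; last 2 first.
- exact: L1_min.
- by apply: filterS fg => x /min_idPl.
by apply: le_Rintegral => //; [exact: L1_min|move=> x _; rewrite ge_min lexx orbT].
Qed.

Lemma E_le f g : L1 f -> L1 g -> (forall x, f x <= g x) -> E f <= E g.
Proof. by move=> if_ ig fg; apply: E_ae_le => //; exact: nearW. Qed.

Lemma limn_einf_le (u : nat -> \bar R) (K : \bar R) :
  (forall n, (u n <= K)%E) -> (limn_einf u <= K)%E.
Proof.
move=> uK; rewrite limn_einf_lim; apply: lime_le; first exact: is_cvg_einfs.
apply: nearW => n; apply: le_trans (uK n).
by apply: ereal_inf_lbound; exists n => /=.
Qed.

Lemma limn_einf_ge (u : nat -> \bar R) (K : \bar R) :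
  (\forall n \near \oo, (K <= u n)%E) -> (K <= limn_einf u)%E.
Proof.
move=> [N _ uK]; rewrite limn_einf_lim; apply: lime_ge; first exact: is_cvg_einfs.
exists N => // n /= Nn; apply: le_ereal_inf_tmp => _ [m /= nm <-].
by apply: uK; exact: leq_trans Nn nm.
Qed.

Lemma fatou_liminf (f : nat -> T -> R) (K : R) :
  (forall n, L1 (f n)) -> (forall n x, 0 <= f n x) ->
  (forall n, E (f n) <= K) ->
  (\int[P]_x limn_einf (fun n => (f n x)%:E) <= K%:E)%E.
Proof.
move=> if_ f0 fK.
apply: (le_trans (fatou P measurableT _ _)) => //.
- by move=> n; exact: measurable_int (if_ n).
- by move=> n x _; rewrite lee_fin.
by apply: limn_einf_le => n; rewrite L1_EFinE// lee_fin.
Qed.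

Lemma L1_ae_eq f g : measurable_fun setT g -> L1 f ->
  (\forall x \ae P, f x = g x) -> L1 g.
Proof.
move=> mg if_ fg; apply/integrableP; split; first exact/measurable_EFinP.
have /integrableP[mf] := if_; apply: le_lt_trans; apply: ae_ge0_le_integral => //.
- by apply: measurableT_comp => //; exact/measurable_EFinP.
- exact: measurableT_comp.
- by apply: filterS fg => x /= ->.
Qed.

(** Positive parts turn almost sure nonnegativity into nonnegativity everywhere without changing any
    mean. Integrability of the limit is part of the conclusion, since it is needed for limits of
    cocycles. *)
Lemma fatou_ae (f : nat -> T -> R) (g : T -> R) (K : R) :
  (forall n, L1 (f n)) -> (forall n, \forall x \ae P, 0 <= f n x) ->
  (forall n, E (f n) <= K) -> measurable_fun setT g ->
  (\forall x \ae P, (fun n => f n x) @ \oo --> g x) -> L1 g /\ E g <= K.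
Proof.
move=> if_ f0 fK mg fg.
have f0' : \forall x \ae P, forall n, 0 <= f n x by exact/ae_foralln.
pose f' n x := Num.max (f n x) 0; pose g' x := Num.max (g x) 0.
have if' n : L1 (f' n) by apply: L1_max => //; exact: L1_cst.
have f'0 n x : 0 <= f' n x by rewrite /f' le_max lexx orbT.
have g'0 x : 0 <= g' x by rewrite /g' le_max lexx orbT.
have mg' : measurable_fun setT g' by apply: measurable_maxr.
have gg' : \forall x \ae P, g' x = g x.
  apply: filterS2 f0' fg => x h hg; apply/max_idPl.
  rewrite -(cvg_lim _ hg)//; apply: limr_ge; first by apply/cvg_ex; exists (g x).
  exact: nearW.
have ig'K : (\int[P]_x (g' x)%:E <= K%:E)%E.
  apply: le_trans (@fatou_liminf f' K if' f'0 _).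
    apply: ae_ge0_le_integral => //.
    - by move=> x _; rewrite lee_fin.
    - exact/measurable_EFinP.
    - by move=> x _; apply: limn_einf_ge; apply: nearW => n; rewrite lee_fin.
    - rewrite /limn_einf; apply: measurableT_comp => //.
      apply: measurable_fun_limn_esup => n.
      by apply: measurableT_comp => //; exact: measurable_int (if' n).
    - apply: filterS3 f0' fg gg' => x h hg -> _.
      have -> : (fun n => (f' n x)%:E) = (fun n => (f n x)%:E).
        by apply/funext => n; rewrite /f' (max_idPl (h n)).
      have /cvg_limn_einf_sup[-> //] : (fun n => (f n x)%:E) @ \oo --> (g x)%:E.
      by apply: cvg_EFin => //; exact: nearW.
  move=> n; rewrite (@E_ae_eq _ (f n)) //.
  by apply: filterS f0' => x /(_ n) /max_idPl.
have ig' : L1 g'.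
  apply/integrableP; split; first exact/measurable_EFinP.
  under eq_integral do rewrite /= ger0_norm//.
  exact: le_lt_trans ig'K (ltry _).
have ig : L1 g by exact: L1_ae_eq ig' gg'.
by split=> //; rewrite -(E_ae_eq ig' ig gg') -lee_fin -L1_EFinE.
Qed.

Lemma dominated_E_cvg (f : nat -> T -> R) (g h : T -> R) :
  (forall n, measurable_fun setT (f n)) -> measurable_fun setT g -> L1 h ->
  (\forall x \ae P, (fun n => f n x) @ \oo --> g x) ->
  (forall n x, `|f n x| <= h x) ->
  (fun n => E (f n)) @ \oo --> E g.
Proof.
move=> mf mg ih fg fh.
have [] := @dominated_convergence _ T R P setT measurableT
  (fun n x => (f n x)%:E) (EFin \o g) (EFin \o h).
- by move=> n; exact/measurable_EFinP.
- exact/measurable_EFinP.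
- apply: filterS fg => x fgx _.
  by apply: cvg_EFin => //; exact: nearW.
- exact: ih.
- by apply: nearW => x n _; rewrite lee_fin.
move=> ig _ fgE.
by move: fgE; rewrite (L1_EFinE ig) => /fine_cvg.
Qed.

End mean.

(** The geometric weights upgrade summable squares to summable absolute increments, so the
    telescoping series converges absolutely. *)
Lemma weighted_squares_cvg (R : realType) (a : nat -> R) (M : R) :
  (forall n, \sum_(0 <= j < n) 2 ^+ j * (a j - a j.+1) ^+ 2 <= M) -> cvgn a.
Proof.
move=> aM.
have geoB n : \sum_(0 <= j < n) (2^-1 : R) ^+ j <= 2.
  have -> : \sum_(0 <= j < n) (2^-1 : R) ^+ j = 2 - 2 * 2^-1 ^+ n.
    elim: n => [|n IH]; first by rewrite big_nil expr0 mulr1 subrr.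
    by rewrite big_nat_recr//= IH exprS; field.
  by rewrite gerBl mulr_ge0// exprn_ge0.
(* AM-GM: |a_j - a_(j+1)| <= 2^-j + 2^j (a_j - a_(j+1))^2 *)
have amgm (t u v : R) : u * v = 1 -> 0 <= u -> 0 <= v ->
    `|t| <= u + v * t ^+ 2.
  move=> uv u0 v0; rewrite -(real_normK (num_real t)).
  have := normr_ge0 t; set y := `|t| => y0.
  have : 0 <= v * (y - u) ^+ 2 by rewrite mulr_ge0// sqr_ge0.
  have -> : v * (y - u) ^+ 2 = v * y ^+ 2 - 2 * (u * v) * y + u * (u * v) by ring.
  by rewrite uv; lra.
have ab n : \sum_(0 <= j < n) `|telescope a j| <= 2 + M.
  apply: le_trans (lerD (geoB n) (aM n)); rewrite -big_split /=.
  apply: ler_sum => j _; rewrite /telescope /= distrC.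
  apply: amgm; rewrite ?exprn_ge0//.
  by rewrite -exprMn mulVf// expr1n.
have nc : cvgn [normed series (telescope a)].
  apply: nondecreasing_is_cvgn.
    by apply/nondecreasing_seqP => n; rewrite /normed_series_of /series /= big_nat_recr//= lerDl.
  by exists (2 + M) => _ [n _ <-]; exact: ab.
have := normed_cvg nc; rewrite telescopeK => /cvg_ex[l al].
apply/cvg_ex; exists (l + a 0%N).
have aE : a = [sequence a n - a 0%N]_n \+ cst (a 0%N).
  by apply/funext => n /=; rewrite subrK.
by rewrite {1}aE; apply: (cvgD al); exact: cvg_cst.
Qed.

Lemma ae_all_countable d (T : measurableType d) (R : realType)
    (P : probability T R) (I : countType) (Q : I -> T -> Prop) :
  (forall i, \forall w \ae P, Q i w) -> \forall w \ae P, forall i, Q i w.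
Proof.
move=> Qi.
have : \forall w \ae P, forall n,
    if @choice.unpickle I n is Some i then Q i w else True.
  by apply: ae_foralln => n; case: choice.unpickle => [i|] //; exact: nearW.
by apply: filterS => w H i; have := H (choice.pickle i); rewrite choice.pickleK.
Qed.

(** * Almost sure convergence from convexity *)

Section convex_compactness.
Context d (T : measurableType d) (R : realType) (P : probability T R).

Lemma L1_ae_bounded (f : T -> R) (c : R) : measurable_fun setT f ->
  (\forall w \ae P, `|f w| <= c) -> L1 P f.
Proof.
(* This truncation is bounded everywhere and agrees with [f] almost surely. The absolute value of
   [c] avoids having to know beforehand that [c] is nonnegative. *)
move=> mf fc; pose g w := Num.max (- `|c|) (Num.min (f w) `|c|).
apply: (@L1_ae_eq _ _ _ P g) => //.
  apply: (L1_le (g := fun=> `|c|)); last exact: L1_cst.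
    by apply: measurable_maxr => //; exact: measurable_minr.
  move=> w; rewrite /g ler_norml le_max lexx /= ge_max ge_min lexx orbT andbT.
  by rewrite lerNl (le_trans _ (normr_ge0 c))// oppr_le0.
apply: filterS fc => w fc; rewrite /g.
have cc : c = `|c| by rewrite ger0_norm// (le_trans _ fc).
move: fc; rewrite ler_norml [in X in X -> _]cc => /andP[fl fr].
by rewrite (min_idPl fr) (max_idPr fl).
Qed.

(** By Fatou the limit inferior is integrable, hence almost surely finite, and every tail of the
    sequence has a value below it plus 1. Bounds along infinitely many indices suffice later: they
    bound every term of an increasing sequence, and they bound a limit. *)
Lemma ae_frequently_bounded (f : nat -> T -> R) (K : R) :
  (forall n, L1 P (f n)) -> (forall n, \forall w \ae P, 0 <= f n w) ->
  (forall n, E P (f n) <= K) ->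
  \forall w \ae P, exists M, forall n, exists2 m, (n <= m)%N & f m w <= M.
Proof.
move=> if_ f0 fK.
pose g n w := Num.max (f n w) 0.
have ig n : L1 P (g n) by apply: L1_max => //; exact: L1_cst.
have g0 n w : 0 <= g n w by rewrite /g le_max lexx orbT.
have gK n : E P (g n) <= K.
  rewrite (@E_ae_eq _ _ _ P _ (f n)) //.
  by apply: filterS (f0 n) => x /max_idPl.
pose h w := limn_einf (fun n => (g n w)%:E).
have mh : measurable_fun setT h.
  rewrite /h /limn_einf; apply: measurableT_comp => //.
  apply: measurable_fun_limn_esup => n.
  by apply: measurableT_comp => //; exact: measurable_int (ig n).
have h0 w : (0 <= h w)%E by apply: limn_einf_ge; apply: nearW => n; rewrite lee_fin.
have ih : P.-integrable setT h.
  apply/integrableP; split => //.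
  under eq_integral do rewrite gee0_abs//.
  exact: le_lt_trans (fatou_liminf ig g0 gK) (ltry _).
apply: filterS (integrable_ae measurableT ih) => w /(_ Logic.I) hfin.
exists (fine (h w) + 1) => n.
have : (einfs (fun n => (g n w)%:E) n < (fine (h w) + 1)%:E)%E.
  apply: (@le_lt_trans _ _ (h w)).
    rewrite /h limn_einf_lim.
    apply: lime_ge; first exact: is_cvg_einfs.
    by exists n => // m /= nm; exact: nondecreasing_einfs.
  by rewrite -[X in (X < _)%E]fineK// lte_fin ltrDl.
move=> /ereal_inf_lt [_ /= [m /= nm <-]]; rewrite lte_fin => /ltW gm.
by exists m => //; apply: le_trans gm; rewrite /g le_max lexx.
Qed.

(* A minimising sequence of E (sum_i exp (- ev x i)) over the sets C k is Cauchy,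
   because the midpoint of x and y lowers the mean of the two values by half of
   E (sum_i (exp (- ev x i / 2) - exp (- ev y i / 2)) ^ 2). *)
Lemma convex_sets_ae_cvg (X : Type) (I : finType) (mid : X -> X -> X)
    (ev : X -> I -> T -> R) (K : I -> R) (C : nat -> set X) :
  (forall x y i w, ev (mid x y) i w = (ev x i w + ev y i w) / 2) ->
  (forall k, C k.+1 `<=` C k) ->
  (forall k, C k !=set0) ->
  (forall k x y, C k x -> C k y -> C k (mid x y)) ->
  (forall k x i, C k x -> [/\ L1 P (ev x i), \forall w \ae P, 0 <= ev x i w
    & E P (ev x i) <= K i]) ->
  exists x : nat -> X, (forall k, C k (x k)) /\
    forall i, \forall w \ae P, cvgn (fun k => ev (x k) i w).
Proof.
move=> ev_mid C_decr C0 C_mid C_ev.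
have C_le k m : (k <= m)%N -> C m `<=` C k.
  move=> /subnK <-; elim: (m - k)%N => [|j IH] //.
  by rewrite addSn; apply: subset_trans IH; exact: C_decr.
pose a x i w := expR (- (ev x i w / 2)).
have La k x y i : C k x -> C k y -> L1 P (fun w => a x i w * a y i w).
  move=> /C_ev -/(_ i)[lx x0 _] /C_ev -/(_ i)[ly y0 _].
  have ma z : L1 P (ev z i) -> measurable_fun setT (a z i).
    move=> lz; apply: measurableT_comp => //; apply: measurableT_comp => //.
    by apply: measurable_funM => //; exact: L1_measurable lz.
  apply: (@L1_ae_bounded _ 1); first by apply: measurable_funM; exact: ma.
  apply: filterS2 x0 y0 => w x0 y0.
  rewrite /a -expRD ger0_norm ?expR_ge0// -[leRHS]expR0 ler_expR.
  by lra.
pose Phi x := E P (fun w => \sum_i a x i w * a x i w).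
have Phi_ge0 x : 0 <= Phi x.
  by apply: E_ge0 => w; apply: sumr_ge0 => i _; rewrite -expr2 sqr_ge0.
have Phi_E k x : C k x -> Phi x = \sum_i E P (fun w => a x i w * a x i w).
  by move=> Ckx; apply: E_sum => i; exact: (La _ _ _ _ Ckx Ckx).
have Phi_le k x : C k x -> Phi x <= \sum_(i : I) 1.
  move=> Cx; rewrite (Phi_E _ _ Cx); apply: ler_sum => i _.
  rewrite -[leRHS](E_cst P); apply: E_ae_le; [exact: (La _ _ _ _ Cx Cx)|exact: L1_cst|].
  have [_ x0 _] := C_ev _ _ i Cx; apply: filterS x0 => w x0.
  by rewrite /a -expRD -[leRHS]expR0 ler_expR; lra.
pose S x y w := \sum_i (a x i w - a y i w) ^+ 2.
have S_expand k x y w : S x y w = (\sum_i a x i w * a x i w) +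
    (\sum_i a y i w * a y i w) - 2 * (\sum_i a (mid x y) i w * a (mid x y) i w).
  rewrite mulr_sumr -big_split -sumrB /=; apply: eq_bigr => i _.
  suff -> : a (mid x y) i w * a (mid x y) i w = a x i w * a y i w by ring.
  by rewrite /a ev_mid -!expRD; congr expR; field.
pose Ik k := inf [set Phi x | x in C k].
have Ik_inf k : has_inf [set Phi x | x in C k].
  split; first by have [x Cx] := C0 k; exists (Phi x), x.
  by exists 0 => _ [x _ <-].
have Ik_le k x : C k x -> Ik k <= Phi x.
  by move=> Cx; apply: ge_inf; [exact: (Ik_inf k).2|exists x].
(* The sets shrink, so the infima [Ik] increase; they are bounded by the cardinality of [I], and [J]
   is their limit. *)
pose J := sup (range Ik).
have J_sup : has_sup (range Ik).
  split; first by exists (Ik 0%N), 0%N.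
  exists (\sum_(i : I) 1) => _ [k _ <-].
  have [x Cx] := C0 k; exact: le_trans (Ik_le _ _ Cx) (Phi_le _ _ Cx).
have Ik_J k : Ik k <= J by apply: ub_le_sup; [exact: J_sup.2|exists k].
have Ik_homo k m : (k <= m)%N -> Ik k <= Ik m.
  move=> km; apply: lb_le_inf; first exact: (Ik_inf m).1.
  by move=> _ [x Cx <-]; apply: Ik_le; exact: (C_le _ _ km).
(* The rate 4^-j beats the weights 2^j of [weighted_squares_cvg]. *)
pose delta j : R := 4^-1 ^+ j.
have delta_gt0 j : 0 < delta j by rewrite exprn_gt0.
(* The index of the set may have to run ahead of [j], because its infimum must already be within
   [delta j] of [J]. *)
have /choice[u uP] : forall j, exists xk : X * nat, [/\ (j <= xk.2)%N,
    C xk.2 xk.1, Phi xk.1 < J + delta j & J - delta j < Ik xk.2].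
  move=> j; have [_ [k _ <-] kJ] := sup_adherent (delta_gt0 j) J_sup.
  pose m := maxn j k.
  have [_ [x Cx <-] xI] := inf_adherent (delta_gt0 j) (Ik_inf m).
  exists (x, m); split => //=; first exact: leq_maxl.
    by apply: lt_le_trans xI _; rewrite lerD2r Ik_J.
  by apply: lt_le_trans kJ _; apply: Ik_homo; exact: leq_maxr.
pose x j := (u j).1.
have Cx j : C j (x j) by have [jk Ck _ _] := uP j; exact: (C_le _ _ jk).
exists x; split => //.
have LS j : L1 P (S (x j) (x j.+1)).
  rewrite /S; apply: L1_sum => i.
  under eq_fun do rewrite expr2 mulrBl !mulrBr.
  have C1 := C_decr _ _ (Cx j.+1).
  by apply: L1B; apply: L1B; exact: (La j _ _ _).
have ES j : E P (S (x j) (x j.+1)) <= 4 * delta j.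
  have C1 := C_decr _ _ (Cx j.+1).
  have Cm := C_mid _ _ _ (Cx j) C1.
  have LP y : C j y -> L1 P (fun w => \sum_i a y i w * a y i w).
    by move=> Cy; apply: L1_sum => i; exact: (La _ _ _ _ Cy Cy).
  have -> : E P (S (x j) (x j.+1)) =
      Phi (x j) + Phi (x j.+1) - 2 * Phi (mid (x j) (x j.+1)).
    rewrite /Phi -(EZ 2 (LP _ Cm)) -(ED (LP _ (Cx j)) (LP _ C1)) -EB.
    - by congr E; apply/funext => w; exact: S_expand.
    - by apply: L1D; exact: LP.
    - exact/L1Z/LP.
  have [jk Cjk Pj Ij] := uP j; have [jk' Cjk' Pj' Ij'] := uP j.+1.
  have Dj : delta j.+1 <= delta j.
    by rewrite /delta exprS; have := ltW (delta_gt0 j); rewrite /delta; lra.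
  (* Then the mean of [S] is at most 2 (J + delta j) - 2 (J - delta j) = 4 delta j. The midpoint is
     only known to lie in the larger of the two sets, the one with the smaller index. *)
  suff : J - delta j <= Phi (mid (x j) (x j.+1)) by move: Pj Pj'; rewrite /x; lra.
  pose m := minn (u j).2 (u j.+1).2.
  apply: (@le_trans _ _ (Ik m)).
    rewrite /m; case: (leqP (u j).2 (u j.+1).2) => _; first exact: ltW.
    by apply: le_trans (ltW Ij'); rewrite lerD2l lerN2.
  apply: Ik_le; apply: C_mid; [apply: C_le Cjk|apply: C_le Cjk'].
    exact: geq_minl.
  exact: geq_minr.
have : \forall w \ae P, exists M, forall n, exists2 m, (n <= m)%N &
    \sum_(0 <= j < m) 2 ^+ j * S (x j) (x j.+1) w <= M.
  (* The bound 8 is the sum over j of 2^j times 4 times 4^-j. *)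
  apply: (ae_frequently_bounded (K := 8)).
  - by move=> n; apply: L1_sum => j; exact/L1Z/LS.
  - move=> n; apply: nearW => w; apply: sumr_ge0 => j _.
    by rewrite mulr_ge0// ?exprn_ge0//; apply: sumr_ge0 => i _; exact: sqr_ge0.
  - move=> n; rewrite E_sum; last by move=> j; exact/L1Z/LS.
    apply: (@le_trans _ _ (\sum_(0 <= j < n) 4 * (2^-1) ^+ j)).
      apply: ler_sum => j _; rewrite EZ//.
      apply: le_trans (ler_wpM2l _ (ES j)) _; first exact: exprn_ge0.
      rewrite mulrCA /delta -exprMn.
      by have -> : 2 * 4^-1 = 2^-1 :> R by field.
    suff -> : \sum_(0 <= j < n) 4 * (2^-1 : R) ^+ j = 8 - 8 * 2^-1 ^+ n.
      by rewrite gerBl mulr_ge0// exprn_ge0.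
    elim: n => [|n IH]; first by rewrite big_nil expr0 mulr1 subrr.
    by rewrite big_nat_recr//= IH exprS; field.
move=> S_bounded i.
have f_bounded : \forall w \ae P, exists M, forall n, exists2 m, (n <= m)%N &
    ev (x m) i w <= M.
  apply: (ae_frequently_bounded (K := K i)) => n;
  by have [] := C_ev _ _ i (Cx n).
apply: filterS2 S_bounded f_bounded => w [M SM] [M' fM].
have /cvg_ex[l al] : cvgn (fun j => a (x j) i w).
  apply: (@weighted_squares_cvg _ _ M) => n.
  (* The weighted sums increase with their length, so bounding infinitely many of them bounds
     all. *)
  have [m nm] := SM n; apply: le_trans.
  rewrite (big_cat_nat _ nm)//=; apply: ler_wpDr.
    apply: sumr_ge0 => j _; rewrite mulr_ge0 ?exprn_ge0//.
    by apply: sumr_ge0 => k _; exact: sqr_ge0.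
  apply: ler_sum => j _; rewrite ler_wpM2l ?exprn_ge0//.
  rewrite /S (bigD1 i)//= lerDl; apply: sumr_ge0 => k _; exact: sqr_ge0.
(* The limit 0 would mean that [ev] tends to infinity, against [f_bounded]. Positivity makes the
   logarithm continuous at [l], so convergence passes from [a] back to [ev]. *)
have l_gt0 : 0 < l.
  rewrite ltNge; apply/negP => l0.
  have : \forall j \near \oo, a (x j) i w < expR (- (M' / 2)).
    by apply: (cvgr_lt l al); rewrite (le_lt_trans l0)// expR_gt0.
  move=> [N _ Na]; have [m Nm fm] := fM N.
  have := Na m Nm; rewrite /a ltr_expR; lra.
apply/cvg_ex; exists (- 2 * ln l).
have -> : (fun k => ev (x k) i w) = (fun k => - 2 * ln (a (x k) i w)).
  by apply/funext => k; rewrite /a expRK; field.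
apply: cvgM; first exact: cvg_cst.
exact: (continuous_cvg _ (continuous_ln l_gt0) al).
Qed.

End convex_compactness.

(** * Invariance of the i.i.d. measure under shifts *)

Section shift_invariance.
Context (R : realType) (d : nat) (Gamma : ptopologicalType).
Context (P : probability (env d Gamma) R).
Local Notation env := (env d Gamma).

Lemma shift0 (w : env) : shift 0 w = w.
Proof. by apply/funext => y; rewrite /shift add0r. Qed.

Lemma shift_shift (x y : 'rV[int]_d) (w : env) :
  shift x (shift y w) = shift (x + y) w.
Proof. by apply/funext => v; rewrite /shift addrA [y + x]addrC. Qed.

Lemma measurable_shift (z : 'rV[int]_d) :
  measurable_fun setT (shift z : env -> env).
Proof.
apply: (@measurability _ _ env env setT (shift z) (@cylinders d Gamma)) => //.
move=> _ [_ [x [A mA ->]] <-]; rewrite setTI.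
by apply: sub_sigma_algebra; exists (z + x), A.
Qed.

(** Unlike the one-coordinate cylinders, these sets are closed under intersection, as uniqueness of
    measures requires of a generating class. *)
Definition rectangles : set (set env) :=
  [set C | exists (F : {fset 'rV[int]_d}) (A : 'rV[int]_d -> set (borel Gamma)),
    (forall x, measurable (A x)) /\ C = [set w | forall x, x \in F -> A x (w x)]].

Lemma rectangles_setI : setI_closed rectangles.
Proof.
move=> _ _ [F [A [mA ->]]] [F' [A' [mA' ->]]].
exists (F `|` F')%fset, (fun x => (if x \in F then A x else setT) `&`
  (if x \in F' then A' x else setT)); split.
  by move=> x; apply: measurableI; case: ifP.
apply/seteqP; split=> w /=.
  move=> [wA wA'] x; rewrite inE => _; split; case: ifP => // xF.
    exact: wA.
  exact: wA'.
move=> wAA'; split=> x xF.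
  by have [] := wAA' x; rewrite ?inE xF.
by have [] := wAA' x; rewrite ?inE ?xF ?orbT.
Qed.

Lemma measurable_rectangles : (@measurable _ env) = <<s rectangles >>.
Proof.
apply/seteqP; split; apply: smallest_sub; try exact: smallest_sigma_algebra.
  move=> _ [x [A mA ->]]; apply: sub_sigma_algebra.
  exists [fset x]%fset, (fun=> A); split => //.
  apply/seteqP; split=> w /= wA; first by move=> y; rewrite inE => /eqP ->.
  by apply: wA; rewrite inE.
move=> _ [F [A [mA ->]]].
have -> : [set w : env | forall x, x \in F -> A x (w x)] =
    \bigcap_(x in [set` F]) [set w : env | A x (w x)] by [].
apply: fin_bigcap_measurable; first exact: finite_fset.
by move=> x _; apply: sub_sigma_algebra; exists x, (A x).
Qed.

Hypothesis P_iid : iid_product P.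

(** The preimage of a rectangle is the rectangle with the same factors on the translated index set,
    and all sites have the same marginal [mu]. So [P] and its image under the shift agree on a
    generating pi-system. *)
Lemma measure_shift (z : 'rV[int]_d) (A : set env) : measurable A ->
  P (shift z @^-1` A) = P A.
Proof.
move=> mA.
pose Q := pushforward P (shift z : env -> env).
rewrite -[LHS]/(Q A).
apply: (@measure_unique _ R env rectangles (fun=> setT)) => //.
- exact: measurable_rectangles.
- exact: rectangles_setI.
- by move=> _; exists fset0, (fun=> setT); split => //; apply/seteqP.
- by rewrite bigcup_const.
- exact: measurable_shift.
- move=> mz _ [F [B [mB ->]]]; have [mu muP] := P_iid.
  rewrite -[LHS]/(P (shift z @^-1` _)) [RHS]muP//.
  have -> : shift z @^-1` [set w : env | forall x : 'rV[int]_d, x \in F -> B x (w x)] =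
      [set w : env | forall y : 'rV[int]_d,
        y \in [fset (z + x)%R | x in F]%fset -> B (y - z) (w y)].
    apply/seteqP; split=> w /= wB.
      by move=> _ /imfsetP[x /= xF ->]; rewrite addrC addKr; exact: wB.
    move=> x xF; have := wB (z + x); rewrite [z + x - z]addrC addKr; apply.
    by apply/imfsetP; exists x.
  have -> := muP [fset (z + x)%R | x in F]%fset (fun y => B (y - z)) (fun x => mB _).
  rewrite big_imfset /=; last by move=> x y _ _ /addrI.
  by apply: eq_bigr => x _; rewrite [z + x - z]addrC addKr.
- by move=> mz _; rewrite -[X in (X < _)%E]/(P _) preimage_setT probability_setT ltry.
Qed.

Lemma ae_shift (z : 'rV[int]_d) (Q : env -> Prop) :
  (\forall w \ae P, Q w) -> \forall w \ae P, Q (shift z w).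
Proof.
move=> [N [mN PN QN]]; exists (shift z @^-1` N); split.
- by rewrite -[X in measurable X]setTI; exact: measurable_shift.
- by rewrite measure_shift.
- by move=> w /= nQ; apply: QN.
Qed.

Lemma ae_all_shift (Q : env -> Prop) :
  (\forall w \ae P, Q w) -> \forall w \ae P, forall z, Q (shift z w).
Proof.
by move=> Qw; apply: ae_all_countable => z; exact: ae_shift.
Qed.

Lemma L1_shift (z : 'rV[int]_d) (f : env -> R) :
  L1 P f -> L1 P (fun w => f (shift z w)).
Proof.
move=> lf; have /integrableP[mf fi] := lf.
have mfz := measurableT_comp mf (measurable_shift z).
apply/integrableP; split => //.
suff -> : (\int[P]_w `|(EFin \o (fun w => f (shift z w))) w| =
  \int[P]_w `|(EFin \o f) w|)%E by [].
have mabs : measurable_fun setT (fun w => `|(EFin \o f) w|%E).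
  exact: measurableT_comp.
rewrite -[LHS](ge0_integral_pushforward (measurable_shift z) P measurableT mabs) //.
by apply: eq_measure_integral => [|mz A mA _]; [exact: measurable_shift|exact: measure_shift].
Qed.

Lemma E_shift (z : 'rV[int]_d) (f : env -> R) :
  L1 P f -> E P (fun w => f (shift z w)) = E P f.
Proof.
move=> lf; rewrite /E /Rintegral; congr fine.
have mf := measurable_int _ lf.
rewrite -[LHS](integral_pushforward (measurable_shift z) mf _ measurableT).
  by apply: eq_measure_integral => [|mz A mA _]; [exact: measurable_shift|exact: measure_shift].
exact: L1_shift.
Qed.

End shift_invariance.

(** * Scalar product and additive functions on the lattice *)

Section dot_product.
Context (R : realType) (d : nat).
Implicit Types u v w : 'rV[R]_d.

Lemma dotDr u v w : dot u (v + w) = dot u v + dot u w.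
Proof. by rewrite /dot -big_split; apply: eq_bigr => i _; rewrite mxE mulrDr. Qed.

Lemma dotDl u v w : dot (v + w) u = dot v u + dot w u.
Proof. by rewrite /dot -big_split; apply: eq_bigr => i _; rewrite mxE mulrDl. Qed.

Lemma dotZr (c : R) u v : dot u (c *: v) = c * dot u v.
Proof. by rewrite /dot mulr_sumr; apply: eq_bigr => i _; rewrite mxE mulrCA. Qed.

Lemma dotZl (c : R) u v : dot (c *: u) v = c * dot u v.
Proof. by rewrite /dot mulr_sumr; apply: eq_bigr => i _; rewrite mxE mulrA. Qed.

Lemma dot0r u : dot u 0 = 0.
Proof. by rewrite -(scale0r 0) dotZr mul0r. Qed.

Lemma dotNr u v : dot u (- v) = - dot u v.
Proof. by rewrite -scaleN1r dotZr mulN1r. Qed.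

Lemma dotBr u v w : dot u (v - w) = dot u v - dot u w.
Proof. by rewrite dotDr dotNr. Qed.

Lemma toRB (x y : 'rV[int]_d) : toR R (x - y) = toR R x - toR R y.
Proof. by apply/rowP => i; rewrite !mxE rmorphB. Qed.

Lemma toRD (x y : 'rV[int]_d) : toR R (x + y) = toR R x + toR R y.
Proof. by apply/rowP => i; rewrite !mxE rmorphD. Qed.

Lemma toR0 : toR R (0 : 'rV[int]_d) = 0.
Proof. by apply/rowP => i; rewrite !mxE. Qed.

(** The lattice is free on the unit vectors, so the values of [phi] there are the coordinates of
    [h]. *)
Lemma additive_dot (phi : 'rV[int]_d -> R) :
  (forall x y, phi (x - y) = phi x - phi y) ->
  exists h : 'rV[R]_d, forall x, phi x = dot h (toR R x).
Proof.
move=> phiB.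
pose f : {additive 'rV[int]_d -> R} :=
  HB.pack_for {additive 'rV[int]_d -> R} phi
    (GRing.isZmodMorphism.Build _ _ phi phiB).
exists (\row_i phi (delta_mx 0 i)) => x.
rewrite -[phi]/(f : _ -> _) {1}(row_sum_delta x) (raddf_sum f).
apply: eq_bigr => i _.
have -> : x 0 i *: delta_mx 0 i = delta_mx 0 i *~ x 0 i :> 'rV[int]_d.
  by rewrite -scaler_int intz.
by rewrite (raddfMz f) -mulrzr !mxE /f.
Qed.

End dot_product.

(** * Integrable stationary cocycles and their compactness *)

Section cocycles.
Context (R : realType) (d : nat) (Gamma : ptopologicalType).
Context (P : probability (env d Gamma) R) (P_iid : iid_product P).
Context (steps : {fset 'rV[int]_d}) (steps_gen : generates steps).
Local Notation env := (env d Gamma).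
Local Notation cocycle := (env -> 'rV[int]_d -> 'rV[int]_d -> R).
Implicit Types B : cocycle.

(** Minimality of the generated subgroup, read as an induction principle: a property of the steps
    that is stable under differences holds on the whole lattice. *)
Lemma generates_ind (H : 'rV[int]_d -> Prop) : H 0 ->
  (forall x y, H x -> H y -> H (x - y)) -> (forall z, z \in steps -> H z) ->
  forall x, H x.
Proof.
move=> H0 HB Hs x.
have : smallest (@additive_subgroup d) [set` steps] x by rewrite steps_gen.
by apply; split => //; split.
Qed.

Lemma cocycle0 B : stationary_cocycle P B -> \forall w \ae P, forall x, B w x x = 0.
Proof.
move=> [_]; apply: filterS => w Bw x; have [_] := Bw x x x.
by move/(canRL (addrK _)); rewrite subrr.
Qed.

Lemma cocycle_base B : stationary_cocycle P B ->
  \forall w \ae P, forall x y, B w x y = B w 0 y - B w 0 x.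
Proof.
move=> [_]; apply: filterS => w Bw x y; have [_ <-] := Bw 0 x y.
by rewrite addrC addKr.
Qed.

Lemma cocycle_step B : stationary_cocycle P B ->
  \forall w \ae P, forall x z, B w x (x + z) = B (shift x w) 0 z.
Proof.
move=> [_]; apply: filterS => w Bw x z; have [<- _] := Bw 0 z x.
by rewrite add0r [z + x]addrC.
Qed.

(** Stated for differences to fit [generates_ind] and [additive_dot]. The last term is a shift of
    [B w 0 y], so it has the same mean and the same almost sure properties. *)
Lemma cocycle_sub B : stationary_cocycle P B ->
  \forall w \ae P, forall x y, B w 0 (x - y) = B w 0 x - B (shift (x - y) w) 0 y.
Proof.
move=> /[dup] sB [_]; apply: filterS2 (cocycle_step sB) => w step Bw x y.
have [_ <-] := Bw 0 (x - y) x.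
by have := step (x - y) y; rewrite subrK => <-; rewrite addrK.
Qed.

Lemma K_space_L1 B x y : K_space P B -> L1 P (fun w => B w x y).
Proof. by move=> [_]; exact. Qed.

(** By shift invariance, [cocycle_sub] makes the mean additive, hence linear in x. A vector as in
    the definition of [h_of] therefore exists, and [xget] does not return its default 0. *)
Lemma E_cocycle B : K_space P B ->
  forall x, E P (fun w => B w 0 x) = - dot (h_of P B) (toR R x).
Proof.
move=> KB; have LB x y := K_space_L1 x y KB; have [sB _] := KB.
have EB0 x y : E P (fun w => B w 0 (x - y)) =
    E P (fun w => B w 0 x) - E P (fun w => B w 0 y).
  rewrite -(E_shift P_iid (x - y) (LB 0 y)) -EB//; last exact: L1_shift (LB _ _).
  apply: E_ae_eq => //; first by apply: L1B => //; exact: L1_shift (LB _ _).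
  by apply: filterS (cocycle_sub sB) => w.
have [h hP] := additive_dot EB0.
have := @xgetPex _ 0 [set h : 'rV[R]_d | forall x : 'rV[int]_d,
  ('E_P[fun w => B w 0%R x])%E = (- dot h (toR R x))%:E].
rewrite -/(h_of P B) => H x; apply: EFin_inj.
rewrite -L1_EFinE// -H; first by rewrite unlock.
exists (- h) => y /=; rewrite unlock L1_EFinE// hP.
by rewrite -(scaleN1r h) dotZl mulN1r opprK.
Qed.

Definition mid_cocycle B B' : cocycle := fun w x y => (B w x y + B' w x y) / 2.

Lemma mid_cocycle_K B B' : K_space P B -> K_space P B' ->
  K_space P (mid_cocycle B B').
Proof.
move=> [[mB sB] LB] [[mB' sB'] LB']; split; last first.
  move=> x y; rewrite /mid_cocycle.
  have := L1Z 2^-1 (L1D (LB x y) (LB' x y)); congr (P.-integrable setT _).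
  by apply/funext => w /=; rewrite mulrC.
split.
  move=> x y; apply: measurable_funM => //; exact: measurable_funD.
apply: filterS2 sB sB' => w sB sB' x y z; rewrite /mid_cocycle.
have [<- <-] := sB x y z; have [<- <-] := sB' x y z; split => //.
by field.
Qed.

(** Convergence spreads from the steps to the lattice by [cocycle_sub], because shifts preserve null
    sets. *)
Lemma ae_shift_cvg (Bs : nat -> cocycle) : (forall k, stationary_cocycle P (Bs k)) ->
  (forall z, z \in steps -> \forall w \ae P, cvgn (fun k => Bs k w 0 z)) ->
  \forall w \ae P, forall x y, cvgn (fun k => Bs k w x y).
Proof.
move=> sBs Bs_cvg.
have cvg0 : \forall w \ae P, forall x, cvgn (fun k => Bs k w 0 x).
  apply: ae_all_countable; apply: generates_ind => //.
    have : \forall w \ae P, forall k, Bs k w 0 0 = 0.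
      by apply: ae_foralln => k; apply: filterS (cocycle0 (sBs k)) => w.
    by apply: filterS => w w0; under eq_fun do rewrite w0; exact: is_cvg_cst.
  move=> x y cx cy.
  have sub : \forall w \ae P, forall k,
      Bs k w 0 (x - y) = Bs k w 0 x - Bs k (shift (x - y) w) 0 y.
    by apply: ae_foralln => k; apply: filterS (cocycle_sub (sBs k)) => w.
  apply: filterS3 sub cx (ae_shift P_iid (x - y) cy) => w {}sub {}cx {}cy.
  by under eq_fun do rewrite sub; exact: is_cvgB.
have base : \forall w \ae P, forall k x y, Bs k w x y = Bs k w 0 y - Bs k w 0 x.
  by apply: ae_foralln => k; exact: cocycle_base.
apply: filterS2 cvg0 base => w cvg0 base x y.
by under eq_fun do rewrite base; exact: is_cvgB.
Qed.

Lemma measurable_lim_esup (f : nat -> env -> R) :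
  (forall k, measurable_fun setT (f k)) ->
  measurable_fun setT (fun w => fine (limn_esup (fun k => (f k w)%:E))).
Proof.
move=> mf; apply: measurableT_comp => //.
by apply: measurable_fun_limn_esup => k; exact/measurable_EFinP.
Qed.

(** On the finitely many steps, [convex_sets_ae_cvg] gives limits, and Fatou makes them integrable;
    the cocycle relation extends both facts to all pairs of sites. Mass may escape in the limit, so
    only the upper bound [kappa] on the means survives. *)
Lemma cocycle_compactness (L : 'rV[int]_d -> env -> R) (kappa : 'rV[int]_d -> R)
    (C : nat -> set cocycle) :
  (forall z, z \in steps -> L1 P (L z)) ->
  (forall k, C k.+1 `<=` C k) ->
  (forall k, C k !=set0) ->
  (forall k B B', C k B -> C k B' -> C k (mid_cocycle B B')) ->
  (forall k, C k `<=` K_space P) ->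
  (forall k B z, C k B -> z \in steps -> \forall w \ae P, L z w <= B w 0 z) ->
  (forall k B z, C k B -> z \in steps -> E P (fun w => B w 0 z) <= kappa z) ->
  exists2 Bs : nat -> cocycle, forall k, C k (Bs k) &
  exists2 B, K_space P B & forall z, z \in steps ->
    E P (fun w => B w 0 z) <= kappa z /\
    \forall w \ae P, (fun k => Bs k w 0 z) @ \oo --> B w 0 z.
Proof.
move=> LL C_decr C0 C_mid CK CL Ckappa.
have LBs k B x y : C k B -> L1 P (fun w => B w x y).
  by move=> /CK; exact: K_space_L1.
(* Subtracting the lower bound [L] makes the functions nonnegative almost surely. *)
have [|||||Bs [CBs Bs_cvg]] := @convex_sets_ae_cvg _ _ _ P cocycle steps mid_cocycle
  (fun B z w => B w 0 (fsval z) - L (fsval z) w)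
  (fun z => kappa (fsval z) - E P (L (fsval z))) C.
- by move=> B B' z w; rewrite /mid_cocycle; field.
- exact: C_decr.
- exact: C0.
- exact: C_mid.
- move=> k B z CB; have zs := fsvalP z; have LB := LBs k B 0 (fsval z) CB.
  split; first by apply: L1B => //; exact: LL.
    by apply: filterS (CL k B _ CB zs) => w; rewrite subr_ge0.
  by rewrite EB ?lerD2r//; [exact: Ckappa CB zs|exact: LL].
exists Bs => //.
have sBs k : stationary_cocycle P (Bs k) by have [] := CK k _ (CBs k).
have all_cvg : \forall w \ae P, forall x y, cvgn (fun k => Bs k w x y).
  apply: ae_shift_cvg => // z zs.
  apply: filterS (Bs_cvg [` zs]%fset) => w /= wcvg.
  have -> : (fun k => Bs k w 0 z) = (fun k => (Bs k w 0 z - L z w) + L z w).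
    by apply/funext => k; rewrite subrK.
  by apply: is_cvgD => //; exact: is_cvg_cst.
(* The limit superior is defined and measurable without exceptional set; off a null set it is the
   true limit. *)
pose B w x y := fine (limn_esup (fun k => (Bs k w x y)%:E)).
have mB x y : measurable_fun setT (fun w => B w x y).
  by apply: measurable_lim_esup => k; have [+ _] := sBs k; exact.
have BsB : \forall w \ae P, forall x y, (fun k => Bs k w x y) @ \oo --> B w x y.
  apply: filterS all_cvg => w wcvg x y; have /cvg_ex[l Bl] := wcvg x y.
  suff -> : B w x y = l by [].
  have /cvg_limn_einf_sup[_ eql] : (fun k => (Bs k w x y)%:E) @ \oo --> l%:E.
    by apply: cvg_EFin => //; exact: nearW.
  by rewrite /B eql.
have sB : stationary_cocycle P B.
  split=> //.
  have all_s : \forall w \ae P, forall k x y z,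
      Bs k w (x + z) (y + z) = Bs k (shift z w) x y /\
      Bs k w x y + Bs k w y z = Bs k w x z.
    by apply: ae_foralln => k; have [_ +] := sBs k.
  apply: filterS2 all_s BsB => w ws wB x y z; split.
    rewrite /B; congr (fine (limn_esup _)); apply/funext => k.
    by have [-> _] := ws k x y z.
  have wxz : (fun k => Bs k w x z) @ \oo --> B w x y + B w y z.
    have -> : (fun k => Bs k w x z) = (fun k => Bs k w x y) \+ (fun k => Bs k w y z).
      by apply/funext => k /=; have [_ ->] := ws k x y z.
    exact: (cvgD (wB x y) (wB y z)).
  exact: cvg_unique wxz (wB x z).
have LEB z : z \in steps -> L1 P (fun w => B w 0 z) /\
    E P (fun w => B w 0 z) <= kappa z.
  move=> zs.
  have [|||||lz ez] := @fatou_ae _ _ _ P (fun k w => Bs k w 0 z - L z w)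
    (fun w => B w 0 z - L z w) (kappa z - E P (L z)).
  - by move=> k; apply: L1B; [exact: LBs (CBs k)|exact: LL].
  - by move=> k; apply: filterS (CL k _ z (CBs k) zs) => w; rewrite subr_ge0.
  - move=> k; rewrite EB; [|exact: LBs (CBs k)|exact: LL].
    by rewrite lerD2r; exact: Ckappa (CBs k) zs.
  - by apply: measurable_funB => //; exact: L1_measurable (LL z zs).
  - by apply: filterS BsB => w wB; apply: cvgB => //; exact: cvg_cst.
  have lBz : L1 P (fun w => B w 0 z).
    have := L1D lz (LL z zs); congr L1.
    by apply/funext => w; rewrite subrK.
  by split => //; move: ez; rewrite EB ?lerD2r//; exact: LL.
exists B; last by move=> z zs; split; [exact: (LEB z zs).2|exact: filterS BsB].
split => // x y.
have LB0 : forall x, L1 P (fun w => B w 0 x).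
  apply: generates_ind; last by move=> z /LEB[].
    apply: (L1_ae_eq (mB 0 0) (L1_cst P 0)).
    by apply: filterS (cocycle0 sB) => w ->.
  move=> {}x {}y lx ly.
  apply: (L1_ae_eq (mB _ _) (L1B lx (L1_shift P_iid (x - y) ly))).
  by apply: filterS (cocycle_sub sB) => w ->.
apply: (L1_ae_eq (mB x y) (L1B (LB0 y) (LB0 x))).
by apply: filterS (cocycle_base sB) => w base; rewrite (base x y).
Qed.

End cocycles.

(** * Comparison of almost sure limits with limits of means *)

Section upper_bound.
Context d (T : measurableType d) (R : realType) (P : probability T R).

Lemma E_tail_cvg (Y : T -> R) : L1 P Y ->
  (fun M : nat => E P (fun w => Num.max (Y w - M%:R) 0)) @ \oo --> 0.
Proof.
move=> lY; rewrite -[X in _ --> X](E_cst P).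
apply: (dominated_E_cvg (h := fun w => `|Y w|)).
- move=> M; apply: measurable_maxr => //.
  by apply: measurable_funB => //; exact: L1_measurable lY.
- exact: measurable_cst.
- exact: L1_norm.
- apply: nearW => w; apply: cvg_near_cst; near=> M.
  apply/max_idPr; rewrite subr_le0; near: M.
  exact: nbhs_infty_ger.
- move=> M w; rewrite ger0_norm ?le_max ?lexx ?orbT// ge_max normr_ge0 andbT.
  by rewrite (le_trans _ (ler_norm _))// gerBl.
Unshelve. all: by end_near. Qed.

(** If [l < c], take [m1 < m2] strictly in between. From some [N] on the means stay below [m1],
    while the limit inferior of the functions is almost surely at least [m2]; Fatou for the
    functions raised by [M] gives a contradiction. *)
Lemma ae_lim_le_E_lim (f : nat -> T -> R) (g : nat -> T -> \bar R) (M c l : R) :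
  (forall n, L1 P (f n)) -> (forall n, \forall w \ae P, - M <= f n w) ->
  (fun n => E P (f n)) @ \oo --> l ->
  (forall n, \forall w \ae P, (g n w <= (f n w)%:E)%E) ->
  (\forall w \ae P, (fun n => g n w) @ \oo --> c%:E) ->
  c <= l.
Proof.
move=> lf fM fl gf gc; rewrite leNgt; apply/negP => lc.
pose m1 := (2 * l + c) / 3; pose m2 := (l + 2 * c) / 3.
have [lm1 m12 m2c] : [/\ l < m1, m1 < m2 & m2 < c].
  by split; rewrite /m1 /m2; lra.
have [N _ fN] : \forall n \near \oo, E P (f n) <= m1 by exact: (cvgr_le l fl _ lm1).
pose f' n w := Num.max (f (n + N)%N w + M) 0.
have lfM n : L1 P (fun w => f n w + M) by apply: L1D => //; exact: L1_cst.
have lf' n : L1 P (f' n) by apply: L1_max => //; exact: L1_cst.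
have f'0 n w : 0 <= f' n w by rewrite /f' le_max lexx orbT.
have f'E n : E P (f' n) <= m1 + M.
  rewrite (@E_ae_eq _ _ _ P _ (fun w => f (n + N)%N w + M)) //.
    rewrite ED//; last exact: L1_cst.
    by rewrite E_cst lerD2r; apply: fN; rewrite /= leq_addl.
  by apply: filterS (fM (n + N)%N) => w fw; apply/max_idPl; lra.
have := fatou_liminf lf' f'0 f'E; apply/negP; rewrite -ltNge.
apply: (@lt_le_trans _ _ (Num.max (m2 + M) 0)%:E).
  by rewrite lte_fin lt_max ltrD2r m12.
have -> : ((Num.max (m2 + M) 0)%:E = \int[P]_w (Num.max (m2 + M) 0)%:E)%E.
  by rewrite (L1_EFinE (L1_cst P _)) E_cst.
apply: ae_ge0_le_integral => //.
- by move=> w _; rewrite lee_fin le_max lexx orbT.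
- by move=> w _; apply: limn_einf_ge; apply: nearW => n; rewrite lee_fin.
- rewrite /limn_einf; apply: measurableT_comp => //.
  apply: measurable_fun_limn_esup => n.
  by apply: measurableT_comp => //; exact: measurable_int (lf' n).
have gf' : \forall w \ae P, forall n, (g n w <= (f n w)%:E)%E by exact/ae_foralln.
apply: filterS2 gf' gc => w gfw gcw _; apply: limn_einf_ge.
have [N' _ gN'] : \forall n \near \oo, (m2%:E < g n w)%E.
  have /fine_cvgP[gfin fgc] := gcw.
  apply: filterS2 gfin (cvgr_gt c fgc _ m2c) => n gfin.
  by rewrite -[X in (_ < X)%E]fineK// lte_fin.
exists N' => // n /= N'n.
rewrite lee_fin /f' ge_max !le_max lexx orbT andbT lerD2r; apply/orP; left.
rewrite -lee_fin; apply: le_trans (gfw _); apply: ltW; apply: gN'.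
by rewrite /= (leq_trans N'n)// leq_addr.
Qed.

End upper_bound.

(** * Every cocycle bounds the point-to-point limit from above *)

Section point_to_point_bound.
Context (R : realType) (d : nat) (Gamma : ptopologicalType).
Context (P : probability (env d Gamma) R) (P_iid : iid_product P).
Context (steps : {fset 'rV[int]_d}) (V : env d Gamma -> 'rV[int]_d -> R).
Local Notation env := (env d Gamma).
Local Notation cocycle := (env -> 'rV[int]_d -> 'rV[int]_d -> R).

(** The one-step bound holds at every shift of almost every environment; summed along a path, the
    increments of [B] telescope. *)
Lemma passage_le_cocycle (B : cocycle) (s : R) : stationary_cocycle P B ->
  (\forall w \ae P, forall z, z \in steps -> V w z - B w 0 z <= s) ->
  \forall w \ae P, forall n x, x 0%N = 0 -> admissible steps n x ->
    passage_time V w n x <= B w 0 (x n) + n%:R * s.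
Proof.
move=> sB VB; have [_ addB] := sB.
apply: filterS3 (ae_all_shift P_iid VB) (filterI (cocycle_step sB) (cocycle0 sB)) addB.
move=> w VBw [step B0] addBw; elim=> [|n IH] x x0 adm.
  by rewrite /passage_time big_ord0 x0 B0 mul0r addr0.
rewrite /passage_time big_ord_recr /=.
have /IH : admissible steps n x by move=> k kn; apply: adm; exact: ltnW.
move=> /(_ x0); rewrite /passage_time => IHn.
have := VBw (x n) _ (adm n (ltnSn n)).
have := step (x n) (x n.+1 - x n); rewrite [x n + _]addrC subrK => <-.
have [_ <-] := addBw 0 (x n) (x n.+1).
rewrite -natr1 mulrDl mul1r; move: IHn; lra.
Qed.

Hypothesis V_L1 : forall z, z \in steps -> L1 P (fun w => V w z).

Lemma coord_norm_le (u : 'rV[R]_d) (i : 'I_d) : `|u 0 i| <= `|u|.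
Proof.
by rewrite /Num.norm /= mx_normrE; exact: (le_bigmax _ (fun ij => `|u ij.1 ij.2|) (0, i)).
Qed.

(** The mean of B(0, [n xi]) / n is controlled, but Fatou also needs a lower bound. By
    [passage_le_cocycle] along one fixed path, B(0, [n xi]) + n s is at least minus a sum of shifts
    of [Y]. Adding the tails (Y - M)^+ along that path makes the normalised value at least -M, at
    the price of [E P (tail M)], which vanishes as M grows. *)
Lemma gpp_le_cocycle (br : nat -> 'rV[R]_d -> 'rV[int]_d) (gpp : 'rV[R]_d -> R)
    (B : cocycle) (s : R) (xi : 'rV[R]_d) :
  lattice_approx steps br -> is_gpp P steps V br gpp ->
  K_space P B -> hull R steps xi ->
  (\forall w \ae P, forall z, z \in steps -> V w z - B w 0 z <= s) ->
  gpp xi + dot (h_of P B) xi <= s.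
Proof.
move=> br_approx gpp_lim KB xiU VB; have [sB _] := KB.
have [path_ex [C Cbr]] := br_approx xi xiU.
(* The chosen paths do not depend on the environment, so the shifts along them leave means
   unchanged. *)
have [xs xsP] := choice path_ex.
set h := h_of P B.
pose Y w := \sum_(z : steps) `|V w (fsval z)|.
have LY : L1 P Y by apply: L1_sum => z; apply: L1_norm; apply: V_L1; exact: fsvalP.
have VY w z : z \in steps -> `|V w z| <= Y w.
  move=> zs; rewrite /Y (bigD1 [` zs]%fset)//= lerDl.
  by apply: sumr_ge0 => ? _.
have passage := passage_le_cocycle sB VB.
pose tail M w : R := Num.max (Y w - M%:R) 0.
have Ltail M : L1 P (tail M).
  by apply: L1_max; [apply: L1B => //|]; exact: L1_cst.
(* The path length is [n.+1], so that the division is never by 0. *)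
pose f (M : nat) n w := n.+1%:R^-1 * (B w 0 (br n.+1 xi) +
  \sum_(k < n.+1) tail M (shift (xs n.+1 k) w)) + s.
have Lsum M n : L1 P (fun w => \sum_(k < n.+1) tail M (shift (xs n.+1 k) w)).
  by apply: L1_sum => k; exact: L1_shift.
have Lf M n : L1 P (f M n).
  apply: L1D; last exact: L1_cst.
  by apply: L1Z; apply: L1D => //; exact: K_space_L1.
have Ef M n : E P (f M n) =
    n.+1%:R^-1 * (- dot h (toR R (br n.+1 xi))) + E P (tail M) + s.
  rewrite /f ED ?E_cst; [|by apply: L1Z; apply: L1D => //; exact: K_space_L1|exact: L1_cst].
  rewrite EZ; last by apply: L1D => //; exact: K_space_L1.
  rewrite ED//; last exact: K_space_L1.
  rewrite (E_cocycle P_iid KB) E_sum; last by move=> k; exact: L1_shift.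
  under eq_bigr do rewrite (E_shift P_iid)//.
  by rewrite sumr_const card_ord mulrDr -[E P (tail M) *+ _]mulr_natl mulKf//.
have br_cvg : (fun n => n.+1%:R^-1 * (- dot h (toR R (br n.+1 xi)))) @ \oo --> - dot h xi.
  pose D := \sum_(i < d) `|h 0 i| * C.
  (* The distance of [n xi] from n xi is bounded by [C], hence the error is of order 1/n. *)
  have brD n : `|n.+1%:R^-1 * - dot h (toR R (br n.+1 xi)) - - dot h xi| <= D * n.+1%:R^-1.
    have -> : n.+1%:R^-1 * - dot h (toR R (br n.+1 xi)) - - dot h xi =
        - (n.+1%:R^-1 * dot h (toR R (br n.+1 xi) - n.+1%:R *: xi)).
      rewrite dotBr dotZr mulrBr mulKf// mulrN; ring.
    rewrite normrN normrM gtr0_norm ?invr_gt0// mulrC ler_wpM2r ?invr_ge0//.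
    apply: le_trans (ler_norm_sum _ _ _) _; apply: ler_sum => i _.
    rewrite normrM ler_wpM2l//; apply: le_trans (Cbr n.+1).
    exact: coord_norm_le.
  apply/cvgrPdist_le => e e0.
  have : (fun n => D * n.+1%:R^-1) @ \oo --> D * 0.
    by apply: cvgM; [exact: cvg_cst|exact: cvg_harmonic].
  rewrite mulr0 => /cvgrPdist_le/(_ e e0).
  apply: filterS => n; rewrite sub0r normrN => De.
  rewrite distrC; apply: le_trans (brD n) _.
  exact: le_trans (ler_norm _) De.
have Ef_cvg M : (fun n => E P (f M n)) @ \oo --> - dot h xi + E P (tail M) + s.
  under eq_fun do rewrite Ef.
  by apply: cvgD; [apply: cvgD => //|]; exact: cvg_cst.
have f_lower M n : \forall w \ae P, - M%:R <= f M n w.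
  apply: filterS passage => w pw; rewrite /f.
  have [x0 xn adm] := xsP n.+1.
  have := pw _ _ x0 adm; rewrite xn => pw'.
  have : - (n.+1%:R * M%:R) <= passage_time V w n.+1 (xs n.+1) +
      \sum_(k < n.+1) tail M (shift (xs n.+1 k) w).
    rewrite -big_split /= -mulrN mulr_natl -[in X in _ *+ X](card_ord n.+1) -sumr_const.
    apply: ler_sum => k _.
    have := VY (shift (xs n.+1 k) w) _ (adm k (ltn_ord k)).
    rewrite ler_norml => /andP[+ _].
    have : Y (shift (xs n.+1 k) w) - M%:R <= tail M (shift (xs n.+1 k) w).
      by rewrite /tail le_max lexx.
    lra.
  move=> low; rewrite -lerBlDr ler_pdivlMl ?ltr0n//.
  move: low pw'; lra.
have tail_ge0 M w : 0 <= tail M w by rewrite /tail le_max lexx orbT.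
have f_G M n : \forall w \ae P,
    ((n.+1%:R^-1)%:E * G_point steps V 0 n.+1 (br n.+1 xi) w <= (f M n w)%:E)%E.
  apply: filterS passage => w pw.
  apply: (@le_trans _ _ ((n.+1%:R^-1)%:E * (B w 0 (br n.+1 xi) + n.+1%:R * s)%:E)%E).
    apply: lee_wpmul2l; first by rewrite lee_fin invr_ge0.
    apply: ge_ereal_sup => _ [x [x0 xn adm] <-].
    by rewrite lee_fin -xn; exact: pw.
  rewrite -EFinM lee_fin /f !mulrDr mulKf// lerD2r lerDl mulr_ge0 ?invr_ge0//.
  by apply: sumr_ge0.
have key M : gpp xi <= - dot h xi + E P (tail M) + s.
  apply: ae_lim_le_E_lim (Lf M) (f_lower M) (Ef_cvg M) (f_G M) _.
  apply: filterS (gpp_lim xi xiU) => w.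
  by rewrite -cvg_shiftS.
suff : gpp xi <= - dot h xi + 0 + s by lra.
have : (fun M => - dot h xi + E P (tail M) + s) @ \oo --> - dot h xi + 0 + s.
  by apply: cvgD; [apply: cvgD; [exact: cvg_cst|exact: E_tail_cvg]|exact: cvg_cst].
by move=> /cvgr_to_ge; apply; exact: nearW.
Qed.

End point_to_point_bound.

(** * Point-to-level values and the cocycles built from them *)

Section level_values.
Context (R : realType) (d : nat) (Gamma : ptopologicalType).
Context (P : probability (env d Gamma) R) (P_iid : iid_product P).
Context (steps : {fset 'rV[int]_d}) (steps_gen : generates steps).
Local Notation env := (env d Gamma).
Local Notation cocycle := (env -> 'rV[int]_d -> 'rV[int]_d -> R).
Context (z0 : 'rV[int]_d) (z0_steps : z0 \in steps) (h : 'rV[R]_d).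

Context (W : env -> 'rV[int]_d -> R).
Hypothesis W_L1 : forall z, z \in steps -> L1 P (fun w => W w z).

(** The dynamic programming form of the tilted point-to-level value with potential [W]: a first
    step, then the problem of length [m] in the shifted environment. The default of the maximum is
    the value at the step [z0], so it adds no candidate. *)
Fixpoint level n (w : env) : R :=
  if n is m.+1 then
    \big[Num.max/W w z0 + dot h (toR R z0) + level m (shift z0 w)]_(z <- steps)
      (W w z + dot h (toR R z) + level m (shift z w))
  else 0.

Lemma level_ge n w z : z \in steps ->
  W w z + dot h (toR R z) + level n (shift z w) <= level n.+1 w.
Proof.
move=> zs /=.
exact: (le_bigmax_seq _ z xpredT (fun z => W w z + dot h (toR R z) + level n (shift z w))).
Qed.

Lemma level_attained n w : exists2 z, z \in steps &
  level n.+1 w = W w z + dot h (toR R z) + level n (shift z w).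
Proof.
exact: (bigmax_attained (fun z => W w z + dot h (toR R z) + level n (shift z w))).
Qed.

Lemma L1_level n : L1 P (level n).
Proof.
elim: n => [|n IH]; first exact: L1_cst.
have L1n z : z \in steps ->
    L1 P (fun w => W w z + dot h (toR R z) + level n (shift z w)).
  move=> zs; apply: L1D; last exact: L1_shift.
  by apply: L1D; [exact: W_L1|exact: L1_cst].
apply: (L1_bigmax (F0 := fun w => W w z0 + dot h (toR R z0) + level n (shift z0 w))
  (F := fun z w => W w z + dot h (toR R z) + level n (shift z w))) => //.
exact: L1n.
Qed.

Context (c : R).
Hypothesis W_le : forall w z, z \in steps -> W w z + dot h (toR R z) <= c.

Lemma level_le n w : level n w <= n%:R * c.
Proof.
elim: n w => [|n IH] w; first by rewrite mul0r.
have [z zs ->] := level_attained n w.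
by rewrite -natr1 mulrDl mul1r addrC lerD// W_le.
Qed.

(** An optimal first step is put in front of a path found in the shifted environment. Allowing [W]
    below [V] compares truncated potentials with the original passage times. *)
Lemma level_le_passage (V : env -> 'rV[int]_d -> R) n w :
  (forall w z, z \in steps -> W w z <= V w z) ->
  exists x, [/\ x 0%N = 0, admissible steps n x &
    level n w <= passage_time V w n x + dot h (toR R (x n))].
Proof.
move=> WV; elim: n w => [|n IH] w.
  by exists (fun=> 0); split => //; rewrite /passage_time big_ord0 toR0 dot0r addr0.
have [z zs ->] := level_attained n w.
have [x [x0 adm le]] := IH (shift z w).
exists (fun k => if k is m.+1 then z + x m else 0); split => //.
  move=> [|k] kn; first by rewrite x0 addr0 subr0.
  by rewrite opprD addrACA subrr add0r; exact: adm.
rewrite /passage_time big_ord_recl /= x0 addr0 subr0 shift0 toRD dotDr.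
have -> : \sum_(i < n) V (shift (z + x i) w) (z + x i.+1 - (z + x i)) =
    passage_time V (shift z w) n x.
  apply: eq_bigr => i _; rewrite shift_shift [x i + z]addrC.
  by rewrite opprD addrACA subrr add0r.
by have := WV w z zs; move: le; lra.
Qed.

Definition level_avg n (w : env) : R := n.+1%:R^-1 * \sum_(k < n.+1) level k.+1 w.

(** A gradient plus a linear drift. The gradient has mean zero by shift invariance, so the drift
    alone fixes the mean. *)
Definition level_cocycle n : cocycle := fun w x y =>
  level_avg n (shift x w) - level_avg n (shift y w) - dot h (toR R (y - x)).

Lemma L1_level_avg n : L1 P (level_avg n).
Proof. by apply: L1Z; apply: L1_sum => k; exact: L1_level. Qed.

Lemma level_cocycle_K n : K_space P (level_cocycle n).
Proof.
have LB x y : L1 P (fun w => level_cocycle n w x y).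
  apply: L1B; last exact: L1_cst.
  by apply: L1B; apply: L1_shift => //; exact: L1_level_avg.
split; last exact: LB.
split; first by move=> x y; exact: L1_measurable (LB x y).
apply: nearW => w x y z; rewrite /level_cocycle !shift_shift; split.
  by congr (_ - dot h (toR R _)); rewrite opprD addrACA subrr addr0.
by rewrite !toRB !dotBr; ring.
Qed.

Lemma E_level_cocycle n z :
  E P (fun w => level_cocycle n w 0 z) = - dot h (toR R z).
Proof.
have La x : L1 P (fun w => level_avg n (shift x w)).
  by apply: L1_shift => //; exact: L1_level_avg.
rewrite EB; [|by apply: L1B|exact: L1_cst].
rewrite EB// E_cst !(E_shift P_iid); [|exact: L1_level_avg..].
by rewrite subrr subr0 sub0r.
Qed.

(* Summing level_ge over n telescopes in the shifted environment. *)
Lemma level_cocycle_ge n w z : z \in steps ->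
  W w z - level_cocycle n w 0 z <= n.+1%:R^-1 * level n.+1 (shift z w).
Proof.
move=> zs; rewrite /level_cocycle /level_avg shift0 subr0.
have le : n.+1%:R * (W w z + dot h (toR R z)) + \sum_(k < n.+1) level k.+1 (shift z w)
    <= \sum_(k < n.+1) level k.+1 w + level n.+1 (shift z w).
  elim: n => [|n IH].
    rewrite !big_ord_recl !big_ord0 !addr0 mul1r lerD2r.
    by have := level_ge 0 w zs; rewrite /= addr0.
  rewrite big_ord_recr [X in _ <= X + _]big_ord_recr /= -natr1 mulrDl mul1r.
  by have := level_ge n.+1 w zs; move: IH; rewrite /=; lra.
rewrite -subr_ge0.
have -> : n.+1%:R^-1 * level n.+1 (shift z w) -
    (W w z - (n.+1%:R^-1 * \sum_(k < n.+1) level k.+1 w -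
       n.+1%:R^-1 * \sum_(k < n.+1) level k.+1 (shift z w) - dot h (toR R z))) =
    n.+1%:R^-1 * (\sum_(k < n.+1) level k.+1 w + level n.+1 (shift z w) -
      (n.+1%:R * (W w z + dot h (toR R z)) + \sum_(k < n.+1) level k.+1 (shift z w))).
  rewrite [in RHS]mulrBr [n.+1%:R^-1 * (_ * _ + _)]mulrDr mulKf//; ring.
by rewrite mulr_ge0 ?invr_ge0// subr_ge0.
Qed.

(** Level values lie below [G_level], so their normalised excess over [gpl h] tends to 0 almost
    surely. The bound [c], available for truncated potentials, provides the domination. *)
Lemma level_excess_cvg (V : env -> 'rV[int]_d -> R) (gpl : 'rV[R]_d -> R) :
  (forall w z, z \in steps -> W w z <= V w z) -> is_gpl P steps V gpl ->
  (fun n => E P (fun w => Num.max (n.+1%:R^-1 * level n.+1 w - gpl h) 0)) @ \oo --> 0.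
Proof.
move=> WV gpl_lim; rewrite -[X in _ --> X](E_cst P).
apply: (dominated_E_cvg (h := fun=> `|c - gpl h|)).
- move=> n; apply: measurable_maxr => //; apply: measurable_funB => //.
  by apply: measurable_funM => //; exact: L1_measurable (L1_level _).
- exact: measurable_cst.
- exact: L1_cst.
- apply: filterS (gpl_lim h) => w Gw.
  have levelG n : ((n.+1%:R^-1 * level n.+1 w)%:E <=
      (n.+1%:R^-1)%:E * G_level steps V n.+1 h w)%E.
    have [x [x0 adm le]] := level_le_passage n.+1 w WV.
    rewrite EFinM; apply: lee_wpmul2l; first by rewrite lee_fin invr_ge0.
    apply: le_trans (ereal_sup_ubound _); last by exists x.
    by rewrite lee_fin.
  apply/cvgrPdist_le => e e0.
  have /fine_cvgP[Gfin Gcvg] : (fun n => ((n.+1%:R^-1)%:E * G_level steps V n.+1 h w)%E)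
      @ \oo --> (gpl h)%:E.
    by rewrite (cvg_shiftS (fun n => (n%:R^-1)%:E * G_level steps V n h w)%E).
  have lt_e : gpl h < gpl h + e by rewrite ltrDl.
  apply: filterS2 Gfin (cvgr_le (gpl h) Gcvg _ lt_e) => n Gfin Gle.
  rewrite sub0r normrN ger0_norm ?le_max ?lexx ?orbT// ge_max (ltW e0) andbT.
  rewrite lerBlDl -lee_fin; apply: le_trans (levelG n) _.
  by rewrite -[X in (X <= _)%E]fineK// lee_fin.
- move=> n w; rewrite ger0_norm ?le_max ?lexx ?orbT// ge_max normr_ge0 andbT.
  apply: le_trans (ler_norm _); rewrite lerD2r ler_pdivrMl ?ltr0n//.
  exact: level_le.
Qed.

End level_values.

(** * Cocycles dominating the potential up to the point-to-level limit *)

Section corrector.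
Context (R : realType) (d : nat) (Gamma : ptopologicalType).
Context (P : probability (env d Gamma) R) (P_iid : iid_product P).
Context (steps : {fset 'rV[int]_d}) (steps_gen : generates steps).
Local Notation env := (env d Gamma).
Local Notation cocycle := (env -> 'rV[int]_d -> 'rV[int]_d -> R).
Context (z0 : 'rV[int]_d) (z0_steps : z0 \in steps) (h : 'rV[R]_d).
Context (V : env -> 'rV[int]_d -> R) (gpl : 'rV[R]_d -> R).
Hypothesis gpl_lim : is_gpl P steps V gpl.

Lemma E_le0_ae (f : env -> R) : L1 P f -> (forall w, 0 <= f w) -> E P f <= 0 ->
  \forall w \ae P, f w = 0.
Proof.
move=> lf f0 Ef.
have mf := measurable_int _ lf.
have := (ae_eq_integral_abs P measurableT mf).1.
have -> : (\int[P]_x `|(EFin \o f) x| = 0)%E.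
  under eq_integral do rewrite /= ger0_norm//.
  by rewrite (L1_EFinE lf); congr EFin; apply/le_anti; rewrite Ef E_ge0.
by move=> /(_ erefl); apply: filterS => w /(_ Logic.I) [].
Qed.

Lemma L1_mid (f g : env -> R) : L1 P f -> L1 P g -> L1 P (fun w => (f w + g w) / 2).
Proof.
move=> lf lg; have := L1Z 2^-1 (L1D lf lg); congr L1.
by apply/funext => w; rewrite mulrC.
Qed.

Lemma E_mid (f g : env -> R) : L1 P f -> L1 P g ->
  E P (fun w => (f w + g w) / 2) = (E P f + E P g) / 2.
Proof.
move=> lf lg; rewrite mulrC -ED// -EZ; last exact: L1D.
by congr E; apply/funext => w; rewrite mulrC.
Qed.

(** Level cocycles satisfy the desired bound only up to an excess of small mean. Small mean excess
    is a convex condition, so [cocycle_compactness] applies, and Fatou leaves no excess in the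
    limit. *)
Lemma bounded_corrector (W : env -> 'rV[int]_d -> R) (c : R) :
  (forall z, z \in steps -> L1 P (fun w => W w z)) ->
  (forall w z, z \in steps -> W w z + dot h (toR R z) <= c) ->
  (forall w z, z \in steps -> W w z <= V w z) ->
  exists2 B, K_space P B & forall z, z \in steps ->
    E P (fun w => B w 0 z) <= - dot h (toR R z) /\
    \forall w \ae P, W w z - gpl h <= B w 0 z.
Proof.
move=> LW Wc WV.
pose excess (B : cocycle) z w : R := Num.max (W w z - gpl h - B w 0 z) 0.
have Lexcess B z : K_space P B -> z \in steps -> L1 P (excess B z).
  move=> KB zs; apply: L1_max; last exact: L1_cst.
  apply: L1B; last exact: K_space_L1.
  by apply: L1B; [exact: LW|exact: L1_cst].
(* The cruder almost sure bound with [c] does not depend on [k]; it is the common lower bound that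
   compactness requires. *)
pose C (k : nat) : set cocycle := [set B | K_space P B /\ forall z, z \in steps ->
  [/\ E P (fun w => B w 0 z) <= - dot h (toR R z),
      \forall w \ae P, W w z - c <= B w 0 z & E P (excess B z) <= k.+1%:R^-1]].
have [|||||||Bs CBs [B KB BsB]] := @cocycle_compactness _ _ _ P P_iid steps steps_gen
  (fun z w => W w z - c) (fun z => - dot h (toR R z)) C.
- by move=> z zs; apply: L1B; [exact: LW|exact: L1_cst].
- move=> k B [KB CB]; split => // z zs; have [EB LB XB] := CB z zs; split => //.
  by apply: le_trans XB _; rewrite lef_pV2 ?posrE// ler_nat.
- move=> k.
  have [n _ nk] : \forall n \near \oo, E P (fun w =>
      Num.max (n.+1%:R^-1 * level steps z0 h W n.+1 w - gpl h) 0) <= k.+1%:R^-1.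
    by apply: cvgr_le (level_excess_cvg P_iid z0_steps LW Wc WV gpl_lim) _ _; rewrite invr_gt0.
  (* Its excess at w is at most that of the normalised level value at the environment shifted by z,
     whose mean is small by the choice of [n]. *)
  pose B := level_cocycle steps z0 h W n.
  have KB : K_space P B by exact: level_cocycle_K.
  have Bge w z : z \in steps -> W w z - B w 0 z <=
      n.+1%:R^-1 * level steps z0 h W n.+1 (shift z w) by exact: level_cocycle_ge.
  have Ll : L1 P (fun w => Num.max (n.+1%:R^-1 * level steps z0 h W n.+1 w - gpl h) 0).
    apply: L1_max; last exact: L1_cst.
    by apply: L1B; [apply: L1Z; exact: L1_level|exact: L1_cst].
  exists B; split => // z zs; split.
  + by rewrite E_level_cocycle.
  + apply: nearW => w /=; rewrite lerBlDr -lerBlDl.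
    apply: le_trans (Bge w z zs) _.
    by rewrite ler_pdivrMl ?ltr0n//; exact: (level_le z0_steps Wc).
  + apply: le_trans (nk n (leqnn n)); rewrite -(E_shift P_iid z Ll).
    apply: E_le; [exact: Lexcess|exact: (L1_shift P_iid z Ll)|].
    move=> w; rewrite /excess ge_max !le_max lexx !orbT andbT.
    by rewrite [W w z - _ - _]addrAC lerD2r Bge.
- move=> k B B' [KB CB] [KB' CB']; have KM := mid_cocycle_K KB KB'.
  split=> // z zs; have [EB LB XB] := CB z zs; have [EB' LB' XB'] := CB' z zs.
  split.
  + by rewrite /mid_cocycle E_mid; [lra|exact: K_space_L1..].
  + by apply: filterS2 LB LB' => w; rewrite /mid_cocycle; lra.
  + apply: (@le_trans _ _ ((E P (excess B z) + E P (excess B' z)) / 2)); last first.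
      by rewrite ler_pdivrMr// mulr_natr mulr2n lerD.
    rewrite -E_mid; [|exact: Lexcess..].
    apply: E_le; [exact: Lexcess|exact: L1_mid (Lexcess _ _ KB zs) (Lexcess _ _ KB' zs)|].
    move=> w; rewrite /excess /mid_cocycle ge_max; apply/andP; split.
      have : W w z - gpl h - B w 0 z <= Num.max (W w z - gpl h - B w 0 z) 0.
        by rewrite le_max lexx.
      have : W w z - gpl h - B' w 0 z <= Num.max (W w z - gpl h - B' w 0 z) 0.
        by rewrite le_max lexx.
      lra.
    by rewrite divr_ge0// addr_ge0// le_max lexx orbT.
- by move=> k B [].
- by move=> k B z [_ CB] zs; have [] := CB z zs.
- by move=> k B z [_ CB] zs; have [] := CB z zs.
exists B => // z zs; have [EB Bcvg] := BsB z zs; split => //.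
(* From index [m] on, all members of the sequence have mean excess at most 1/(m+1), so Fatou is
   applied to that tail. *)
have XB m : E P (excess B z) <= m.+1%:R^-1.
  apply: (@fatou_ae _ _ _ P (fun k => excess (Bs (k + m)%N) z) (excess B z) m.+1%:R^-1 _ _ _ _ _).2.
  - by move=> k; apply: Lexcess => //; have [] := CBs (k + m)%N.
  - by move=> k; apply: nearW => w; rewrite /excess le_max lexx orbT.
  - move=> k; have [_ /(_ z zs)[_ _ le]] := CBs (k + m)%N; apply: le_trans le _.
    by rewrite lef_pV2 ?posrE// ler_nat ltnS leq_addl.
  - exact: L1_measurable (Lexcess _ _ KB zs).
  - apply: filterS Bcvg => w Bw.
    have : (fun k => Bs (k + m)%N w 0 z) @ \oo --> B w 0 z.
      by rewrite (cvg_shiftn m (fun k => Bs k w 0 z)).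
    move=> {}Bw; rewrite /excess.
    (* Writing the maximum with an absolute value reduces its limit to continuity of the norm. *)
    under eq_fun do rewrite maxr_absE subr0 addr0.
    rewrite maxr_absE subr0 addr0.
    apply: cvgM; last exact: cvg_cst.
    have Dw : (fun k => W w z - gpl h - Bs (k + m)%N w 0 z) @ \oo -->
      W w z - gpl h - B w 0 z by apply: cvgB => //; exact: cvg_cst.
    by apply: cvgD => //; exact: cvg_norm.
have : E P (excess B z) <= 0.
  have := cvgr_to_ge (@cvg_harmonic R); apply.
  by apply: nearW => m; exact: XB.
move=> /(E_le0_ae (Lexcess _ _ KB zs)) X0.
have : \forall w \ae P, excess B z w = 0.
  by apply: X0 => w; rewrite /excess le_max lexx orbT.
by apply: filterS => w /max_idPr; rewrite subr_le0.
Qed.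

(** Dominating min(V, k) becomes more demanding as k grows, so the sets of admissible cocycles are
    nested, and [bounded_corrector] makes each nonempty. A limit dominates [V] because each value of
    [V] is finite and eventually not truncated. *)
Lemma exists_corrector : (forall z, z \in steps -> L1 P (fun w => V w z)) ->
  exists2 B, K_space P B & forall z, z \in steps ->
    E P (fun w => B w 0 z) <= - dot h (toR R z) /\
    \forall w \ae P, V w z - gpl h <= B w 0 z.
Proof.
move=> LV.
pose W (k : nat) w z := Num.min (V w z) k%:R.
have LW k z : z \in steps -> L1 P (fun w => W k w z).
  by move=> zs; apply: L1_min; [exact: LV|exact: L1_cst].
pose C (k : nat) : set cocycle := [set B | K_space P B /\ forall z, z \in steps ->
  E P (fun w => B w 0 z) <= - dot h (toR R z) /\
  \forall w \ae P, W k w z - gpl h <= B w 0 z].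
(* Truncation at 0 gives an integrable lower bound common to all [k]. *)
have [|||||||Bs CBs [B KB BsB]] := @cocycle_compactness _ _ _ P P_iid steps steps_gen
  (fun z w => W 0%N w z - gpl h) (fun z => - dot h (toR R z)) C.
- by move=> z zs; apply: L1B; [exact: LW|exact: L1_cst].
- move=> k B [KB CB]; split => // z zs; have [EB LB] := CB z zs; split => //.
  apply: filterS LB => w; apply: le_trans; rewrite lerD2r /W.
  rewrite le_min ge_min lexx /= ge_min; apply/orP; right.
  by rewrite ler_nat.
- move=> k; pose c := k%:R + \sum_(z : steps) `|dot h (toR R (fsval z))|.
  have [||B KB BW] := @bounded_corrector (W k) c (LW k).
  + move=> w z zs; apply: lerD; first by rewrite /W ge_min lexx orbT.
    apply: le_trans (ler_norm _) _; rewrite (bigD1 [` zs]%fset)//= lerDl.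
    exact: sumr_ge0.
  + by move=> w z _; rewrite /W ge_min lexx.
  by exists B.
- move=> k B B' [KB CB] [KB' CB']; have KM := mid_cocycle_K KB KB'.
  split=> // z zs; have [EB LB] := CB z zs; have [EB' LB'] := CB' z zs; split.
  + by rewrite /mid_cocycle E_mid; [lra|exact: K_space_L1..].
  + by apply: filterS2 LB LB' => w; rewrite /mid_cocycle; lra.
- by move=> k B [].
- move=> k B z [_ CB] zs; have [_] := CB z zs; apply: filterS => w.
  apply: le_trans; rewrite lerD2r /W le_min ge_min lexx /= ge_min.
  by apply/orP; right; rewrite ler_nat.
- by move=> k B z [_ CB] zs; have [] := CB z zs.
exists B => // z zs; have [EB Bcvg] := BsB z zs; split => //.
have Bsge : \forall w \ae P, forall k, W k w z - gpl h <= Bs k w 0 z.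
  by apply: ae_foralln => k; have [_ /(_ z zs)[]] := CBs k.
apply: filterS2 Bsge Bcvg => w Bsge Bw.
apply: (cvgr_to_ge Bw); near=> k; apply: le_trans (Bsge k).
rewrite lerD2r /W le_min lexx /=; near: k; exact: nbhs_infty_ger.
Unshelve. all: by end_near. Qed.

End corrector.

(** * Subgradients at relative interior points *)

Section subgradient.
Context (R : realType) (d : nat).
Implicit Types (u v xi h : 'rV[R]_d) (A : set 'rV[R]_d).

(** The segment from u to xi, prolonged beyond xi, stays in the affine hull; close enough to xi it
    stays in [A]. *)
Lemma relative_interior_reflect A xi u : relative_interior A xi -> A u ->
  exists2 s : R, 0 < s & A (xi - s *: (u - xi)).
Proof.
move=> [Axi near_xi] Au.
pose l (s : R) := xi - s *: (u - xi).
have aff_l s : affine_hull A (l s).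
  move=> B [affB AB]; rewrite /l.
  have := affB xi u (- s) (AB _ Axi) (AB _ Au); congr B.
  by rewrite scalerBr opprB scalerDl scale1r opprK scaleNr addrA.
have l_cvg : l s @[s --> 0^'+] --> xi.
  apply: cvg_at_right_filter.
  have -> : xi = l 0 by rewrite /l scale0r subr0.
  by apply: cvgB; [exact: cvg_cst|apply: cvgZr_tmp; exact: cvg_id].
near (0 : R)^'+ => s; exists s; first by near: s; exact: nbhs_right_gt.
have : affine_hull A (l s) -> A (l s) by near: s; exact: l_cvg near_xi.
by apply; exact: aff_l.
Unshelve. all: by end_near. Qed.

Context (A : set 'rV[R]_d) (f : 'rV[R]_d -> R) (xi : 'rV[R]_d).
Hypothesis f_convex : forall t u v, 0 <= t <= 1 -> A u -> A v ->
  A (t *: u + (1 - t) *: v) /\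
  f (t *: u + (1 - t) *: v) <= t * f u + (1 - t) * f v.
Hypothesis A_reflect : forall u, A u -> exists2 s : R, 0 < s & A (xi - s *: (u - xi)).

(* One coordinate of h is added at a time, as in the Hahn-Banach theorem. *)
Lemma subgradient_coord (k : nat) : exists h, forall u, A u ->
  (forall i : 'I_d, (k <= i)%N -> u 0 i = xi 0 i) -> f xi + dot h (u - xi) <= f u.
Proof.
elim: k => [|k [h hP]].
  exists 0 => u Au uxi; have -> : u = xi by apply/rowP => i; exact: uxi.
  by rewrite subrr dot0r addr0.
have [kd|dk] := ltnP k d; last first.
  exists h => u Au ukS; apply: hP => // i ki.
  by have := leq_trans dk ki; rewrite leqNgt ltn_ord.
pose ik := Ordinal kd.
pose coord u := u 0 ik - xi 0 ik.
pose g u := f u - f xi - dot h (u - xi).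
pose Ak u := A u /\ forall i : 'I_d, (k.+1 <= i)%N -> u 0 i = xi 0 i.
have mix u v : Ak u -> Ak v -> 0 < coord u -> coord v < 0 ->
    g v / coord v <= g u / coord u.
  move=> [Au uxi] [Av vxi] u0 v0.
  have D0 : 0 < coord u - coord v by lra.
  (* With this weight the mixture of [u] and [v] agrees with [xi] in coordinate [k], so the
     induction hypothesis applies to it. *)
  pose t := - coord v / (coord u - coord v).
  have t01 : 0 <= t <= 1.
    by rewrite /t divr_ge0 ?ler_pdivrMr ?mul1r//=; lra.
  have [Aw fw] := f_convex t01 Au Av.
  have dotw : dot h (t *: u + (1 - t) *: v - xi) =
      t * dot h (u - xi) + (1 - t) * dot h (v - xi).
    by rewrite !dotBr dotDr !dotZr; ring.
  have := hP _ Aw; rewrite dotw => gw.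
  have {}gw : 0 <= t * g u + (1 - t) * g v.
    have : f xi + (t * dot h (u - xi) + (1 - t) * dot h (v - xi)) <=
        t * f u + (1 - t) * f v.
      apply: le_trans fw; apply: gw => i; rewrite leq_eqVlt => /orP[/eqP ki|ki].
        have -> : i = ik by apply: val_inj.
        have : (u 0 ik - xi 0 ik) * t + (v 0 ik - xi 0 ik) * (1 - t) = 0.
          by rewrite -/(coord u) -/(coord v) /t; field; lra.
        by rewrite !mxE; lra.
      by rewrite !mxE uxi// vxi//; lra.
    by rewrite /g; lra.
  have {}gw : 0 <= - coord v * g u + coord u * g v.
    have -> : - coord v * g u + coord u * g v =
        (coord u - coord v) * (t * g u + (1 - t) * g v) by rewrite /t; field; lra.
    by rewrite mulr_ge0// ltW.
  rewrite ler_pdivlMr// mulrAC ler_ndivrMr//; lra.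
(* If no point of the slice has a smaller coordinate [k] than [xi], reflection excludes larger ones
   too, and [h] itself serves. *)
have [[v [Akv v0]]|no_neg] := pselect (exists v, Ak v /\ coord v < 0); last first.
  exists h => u Au uxi; apply: hP => // i; rewrite leq_eqVlt => /orP[/eqP ki|]; last exact: uxi.
  have -> : i = ik by apply: val_inj.
  have [u0|u0|/eqP] := ltgtP (coord u) 0; last by rewrite subr_eq0 => /eqP.
    by exfalso; apply: no_neg; exists u.
  have [s s0 As] := A_reflect Au; exfalso; apply: no_neg.
  exists (xi - s *: (u - xi)); split; last first.
    by rewrite /coord !mxE -/(coord u) addrAC subrr sub0r oppr_lt0 mulr_gt0.
  by split => // j kj; rewrite !mxE (uxi j kj) subrr mulr0 subr0.
have [u [Aku u0]] : exists u, Ak u /\ 0 < coord u.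
  have [Av vxi] := Akv; have [s s0 As] := A_reflect Av.
  exists (xi - s *: (v - xi)); split.
    by split => // j kj; rewrite !mxE (vxi j kj) subrr mulr0 subr0.
  by rewrite /coord !mxE -/(coord v) addrAC subrr sub0r oppr_gt0 pmulr_rlt0.
(* By [mix], slopes on the negative side never exceed those on the positive side, so the supremum of
   the former separates them and is the new coordinate to add to [h]. *)
pose S := [set g v / coord v | v in [set v | Ak v /\ coord v < 0]].
have S_sup : has_sup S.
  split; first by exists (g v / coord v), v.
  by exists (g u / coord u) => _ [v' [Akv' v'0] <-]; exact: mix.
have Sle u' : Ak u' -> 0 < coord u' -> sup S <= g u' / coord u'.
  move=> Aku' u'0; apply: ge_sup; first exact: S_sup.1.
  by move=> _ [v' [Akv' v'0] <-]; exact: mix.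
exists (h + sup S *: delta_mx 0 ik) => u' Au' u'xi.
have dotd : dot (h + sup S *: delta_mx 0 ik) (u' - xi) =
    dot h (u' - xi) + sup S * coord u'.
  rewrite dotDl dotZl; congr (_ + _ * _); rewrite /dot (bigD1 ik)//= big1.
    by rewrite !mxE !eqxx mul1r addr0.
  by move=> i iik; rewrite !mxE (negPf iik) andbF mul0r.
rewrite dotd; suff : sup S * coord u' <= g u' by rewrite /g; lra.
have [c0|c0|c0] := ltgtP (coord u') 0.
- by rewrite -ler_ndivrMr//; apply: ub_le_sup; [exact: S_sup.2|exists u'].
- by rewrite -ler_pdivlMr//; exact: Sle.
- rewrite c0 mulr0.
  have := hP _ Au'; rewrite /g => H; have : f xi + dot h (u' - xi) <= f u'.
    apply: H => i; rewrite leq_eqVlt => /orP[/eqP ki|]; last exact: u'xi.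
    have -> : i = ik by apply: val_inj.
    by apply/eqP; rewrite -subr_eq0; apply/eqP.
  lra.
Qed.

Lemma exists_subgradient : exists h, forall u, A u -> f xi + dot h (u - xi) <= f u.
Proof.
have [h hP] := subgradient_coord d; exists h => u Au; apply: hP => // i.
by rewrite leqNgt ltn_ord.
Qed.

End subgradient.

(** * Duality, minimizers and the variational formula *)

Section variational_formula.
Context (R : realType) (d : nat) (Gamma : ptopologicalType).
Context (P : probability (env d Gamma) R) (P_iid : iid_product P).
Context (steps : {fset 'rV[int]_d}) (steps_gen : generates steps).
Local Notation env := (env d Gamma).
Local Notation cocycle := (env -> 'rV[int]_d -> 'rV[int]_d -> R).

Lemma hull_ind (D : set 'rV[R]_d) :
  (forall t u v, 0 <= t <= 1 -> D u -> D v -> D (t *: u + (1 - t) *: v)) ->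
  (forall z, z \in steps -> D (toR R z)) -> hull R steps `<=` D.
Proof.
move=> D_convex D_steps; apply: smallest_sub; last by move=> _ [z zs <-]; exact: D_steps.
move=> u v t; rewrite !inE => Du Dv.
by apply: (D_convex t%:num) => //; apply/andP; split.
Qed.

Lemma hull_step z : z \in steps -> hull R steps (toR R z).
Proof. by move=> zs; apply: sub_gen_smallest; exists z. Qed.

Lemma hull_nonempty xi : hull R steps xi -> exists z, z \in steps.
Proof.
move=> xiU; apply: contrapT => no_z.
have : hull R steps `<=` set0 by apply: hull_ind => // z zs; apply: no_z; exists z.
by move=> /(_ _ xiU).
Qed.

Lemma hull_dot_le (h h' : 'rV[R]_d) :
  (forall z, z \in steps -> dot h (toR R z) <= dot h' (toR R z)) ->
  forall xi, hull R steps xi -> dot h xi <= dot h' xi.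
Proof.
move=> hh'; apply: hull_ind => // t u v /andP[t0 t1] hu hv.
by rewrite !dotDr !dotZr lerD// ler_wpM2l// subr_ge0.
Qed.

Lemma finite_norm_L1 (f : env -> R) (p : R) : 1 <= p ->
  measurable_fun setT f -> finite_norm P p%:E f -> L1 P f.
Proof.
move=> p1 mf fp.
have : f \in Lfun P p%:E by rewrite inE; apply/andP; split; rewrite inE.
move=> /(Lfun_subset (p := 1%E)) -/(_ _ _ _ _)/Lfun1_integrable.
by apply; rewrite ?lee_fin// fin_num_measure.
Qed.

Lemma cocycle_bound_le (V : env -> 'rV[int]_d -> R) (B : cocycle) (xi : 'rV[R]_d) (s : R) :
  (cocycle_bound P steps V xi B <= s%:E)%E <->
  \forall w \ae P, forall z, z \in steps -> V w z - B w 0 z <= s + dot (h_of P B) xi.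
Proof.
split.
  move/ess_supP; apply: filterS => w le_s z zs; rewrite -lerBlDr -lee_fin.
  apply: le_trans le_s.
  exact: (le_bigmax_seq _ z xpredT
    (fun z => (V w z - B w 0 z - dot (h_of P B) xi)%:E)).
move=> le_s; apply/ess_supP; apply: filterS le_s => w le_s.
rewrite big_seq; apply: bigmax_le; first exact: leNye.
by move=> z zs; rewrite lee_fin lerBlDr; exact: le_s.
Qed.

Context (V : env -> 'rV[int]_d -> R) (gpl gpp : 'rV[R]_d -> R).
Context (br : nat -> 'rV[R]_d -> 'rV[int]_d).
Hypothesis V_L1 : forall z, z \in steps -> L1 P (fun w => V w z).
Hypothesis br_approx : lattice_approx steps br.
Hypothesis gpp_lim : is_gpp P steps V br gpp.

Lemma gpp_le_cocycle_bound B xi : K_space P B -> hull R steps xi ->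
  ((gpp xi)%:E <= cocycle_bound P steps V xi B)%E.
Proof.
move=> KB xiU.
have le_s s : (cocycle_bound P steps V xi B <= s%:E)%E -> gpp xi <= s.
  move=> /cocycle_bound_le H.
  by have := gpp_le_cocycle P_iid V_L1 br_approx gpp_lim KB xiU H; rewrite lerD2r.
case E : (cocycle_bound P steps V xi B) => [r| |].
- by rewrite lee_fin; apply: le_s; rewrite E.
- exact: leey.
(* A bound equal to -oo lies below every real number, in particular below [gpp xi - 1]. *)
- have : gpp xi <= gpp xi - 1 by apply: le_s; rewrite E leNye.
  by rewrite lerDl oppr_ge0 ler10.
Qed.

Hypothesis gpl_lim : is_gpl P steps V gpl.
Hypothesis gpp_concave : convex_function (hull R steps) (fun xi => - gpp xi).
Hypothesis gpl_gpp : forall h : 'rV[R]_d,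
  (gpl h)%:E = ereal_sup [set (gpp xi + dot h xi)%:E | xi in hull R steps].

Lemma gpl_ge h xi : hull R steps xi -> gpp xi + dot h xi <= gpl h.
Proof.
by move=> xiU; rewrite -lee_fin gpl_gpp; apply: ereal_sup_ubound; exists xi.
Qed.

Lemma gpl_le h c : (forall xi, hull R steps xi -> gpp xi + dot h xi <= c) -> gpl h <= c.
Proof.
move=> le_c; rewrite -lee_fin gpl_gpp; apply: ge_ereal_sup => _ [xi xiU <-].
by rewrite lee_fin; exact: le_c.
Qed.

(** A subgradient [h] of the convex function -gpp at xi says that xi maximises gpp + h.u over u in
    the hull, and by [gpl_gpp] that maximum is [gpl h]. *)
Lemma exists_dual xi : relative_interior (hull R steps) xi ->
  exists h, dual gpl gpp xi h.
Proof.
move=> xi_ri; have [xiU _] := xi_ri.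
have [|u uU|h hP] := @exists_subgradient R d (hull R steps) (fun u => - gpp u) xi.
- move=> t u v /andP[t0 t1] uU vU; split.
    move=> D [D_convex Dsteps].
    have := D_convex u v (Itv01 t0 t1); rewrite !inE.
    by apply; [exact: uU|exact: vU].
  by have := gpp_concave (Itv01 t0 t1); apply; rewrite inE.
- exact: relative_interior_reflect.
exists h; apply/le_anti/andP; split; last exact: gpl_ge.
apply: gpl_le => u uU; have /= := hP u uU.
by rewrite dotBr; lra.
Qed.

Lemma exists_minimizer xi : relative_interior (hull R steps) xi ->
  exists B, [/\ K_space P B, (cocycle_bound P steps V xi B <= (gpp xi)%:E)%E
    & dual gpl gpp xi (h_of P B)].
Proof.
move=> xi_ri; have [xiU _] := xi_ri.
have [h h_dual] := exists_dual xi_ri; have [z0 z0_steps] := hull_nonempty xiU.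
have [B KB BP] := exists_corrector P_iid steps_gen z0_steps h gpl_lim V_L1.
have hB z : z \in steps -> dot h (toR R z) <= dot (h_of P B) (toR R z).
  by move=> /BP[+ _]; rewrite (E_cocycle P_iid KB) lerN2.
have VB : \forall w \ae P, forall z, z \in steps -> V w z - B w 0 z <= gpl h.
  apply: ae_all_countable => z.
  have [zs|zs] := boolP (z \in steps); last exact: nearW.
  have [_] := BP z zs; apply: filterS => w le _; lra.
have gplB : gpl (h_of P B) <= gpl h.
  apply: gpl_le => u uU.
  exact: (gpp_le_cocycle P_iid V_L1 br_approx gpp_lim KB uU VB).
have := gpl_ge (h_of P B) xiU; have := hull_dot_le hB xiU; move: h_dual; rewrite /dual.
move=> h_dual le1 le2.
(* The chain gpl h = gpp xi + h.xi <= gpp xi + h(B).xi <= gpl(h(B)) <= gpl h consists of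
   equalities. *)
have gpl_eq : gpl h = gpp xi + dot (h_of P B) xi by lra.
exists B; split => //; last by rewrite /dual; lra.
by apply/cocycle_bound_le; rewrite -gpl_eq.
Qed.

End variational_formula.

Theorem theorem2p12 (R : realType) (d : nat) (Gamma : ptopologicalType)
  (P : probability (env d Gamma) R) (steps : {fset 'rV[int]_d})
  (V : env d Gamma -> 'rV[int]_d -> R) (p : R)
  (br : nat -> 'rV[R]_d -> 'rV[int]_d) (gpl gpp : 'rV[R]_d -> R)
  (Gamma_polish : polish R Gamma)
  (P_iid : iid_product P)
  (steps_0 : ~ hull R steps 0)
  (steps_gen : generates steps)
  (V_meas : forall z, z \in steps ->
     measurable_fun [set: env d Gamma] (fun w => V w z))
  (V_local : forall z, z \in steps ->
     depends_on_finitely_many (fun w => V w z))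
  (p_gt_d : d%:R < p)
  (V_Lp : forall z, z \in steps -> finite_norm P p%:E (fun w => V w z))
  (br_approx : lattice_approx steps br)
  (gpl_lim : is_gpl P steps V gpl)
  (gpl_convex : convex_function [set: 'rV[R]_d] gpl)
  (gpl_lipschitz : exists k : R, forall h h' : 'rV[R]_d,
     `|gpl h - gpl h'| <= k * `|h - h'|)
  (gpp_lim : is_gpp P steps V br gpp)
  (gpp_concave : convex_function (hull R steps) (fun xi => - gpp xi))
  (gpp_continuous : {within hull R steps, continuous gpp})
  (gpl_gpp : forall h : 'rV[R]_d,
     (gpl h)%:E = ereal_sup [set (gpp xi + dot h xi)%:E | xi in hull R steps]) :
  (forall xi : 'rV[R]_d, relative_interior (hull R steps) xi ->
     (gpp xi)%:E =
       ereal_inf [set cocycle_bound P steps V xi B | B in K_space P]) /\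
  (forall xi : 'rV[R]_d, relative_interior (hull R steps) xi ->
     exists B, [/\ K_space P B,
       cocycle_bound P steps V xi B =
         ereal_inf [set cocycle_bound P steps V xi B' | B' in K_space P]
       & dual gpl gpp xi (h_of P B)]).
Proof.
have V_L1 xi : hull R steps xi -> forall z, z \in steps -> L1 P (fun w => V w z).
  move=> xiU z zs; apply: finite_norm_L1 (V_meas z zs) (V_Lp z zs).
  (* The exponent exceeds 1 as soon as d is positive. In dimension 0 every step is 0, which would
     place 0 in the hull. *)
  apply: le_trans (ltW p_gt_d); rewrite ler1n lt0n; apply/eqP => d0.
  apply: steps_0; have -> : 0 = toR R z; last exact: hull_step.
  by apply/rowP => i; move: (ltn_ord i); rewrite {2}d0.
have gpp_le B xi : K_space P B -> hull R steps xi ->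
    ((gpp xi)%:E <= cocycle_bound P steps V xi B)%E.
  move=> KB xiU.
  exact: (gpp_le_cocycle_bound P_iid (V_L1 xi xiU) br_approx gpp_lim).
have minimizer xi (xi_ri : relative_interior (hull R steps) xi) :=
  exists_minimizer P_iid steps_gen (V_L1 xi xi_ri.1) br_approx gpp_lim gpl_lim
    gpp_concave gpl_gpp xi_ri.
have inf_eq xi : relative_interior (hull R steps) xi ->
    (gpp xi)%:E = ereal_inf [set cocycle_bound P steps V xi B | B in K_space P].
  move=> xi_ri; have [B [KB boundB _]] := minimizer xi xi_ri; have [xiU _] := xi_ri.
  apply/le_anti/andP; split.
    by apply: le_ereal_inf_tmp => _ [B' KB' <-]; apply: gpp_le.
  by apply: le_trans boundB; apply: ereal_inf_lbound; exists B.
split => // xi xi_ri; have [B [KB boundB dualB]] := minimizer xi xi_ri.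
exists B; split => //; rewrite -inf_eq//; apply/le_anti; rewrite boundB /=.
by have [xiU _] := xi_ri; apply: gpp_le.
Qed.
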